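(* Assume $\mathbb E[\tanh(h)]=0$, $0<\theta_1<\frac{1}{\mathbb E[\operatorname{sech}^2(h)]}$ and $k=o(n^{2/3})$. For every $\delta>0$ there exists $C>0$ such that, if the samples are drawn from $\mathbb P_S$ with hidden clique $S\subset[n]$, $|S|=k$, and the sample size satisfies $m\ge Ck\log n$, then the set $$S_{\max}:=\operatorname*{arg\,max}_{S':|S'|=k}\phi_{S'},\qquad \phi_{S'}=\frac1k\mathbb 1_{S'}^\top\Big(\frac1m\sum_{i=1}^m\boldsymbol\sigma^{(i)}\boldsymbol\sigma^{(i)\top}\Big)\mathbb 1_{S'},$$ satisfies $$\mathbb P\left(|S\Delta S_{\max}|\ge\delta k\right)=o(1).$$
   Context: Planted random field Curie-Weiss (pRFCW) model. Let $\mu$ be a probability measure on $\mathbb R$, $h\sim\mu$, $\theta_1>0$, $[n]=\{1,\dots,n\}$, and $h_1,\dots,h_n$ i.i.d. $\sim\mu$, $\boldsymbol h=(h_1,\dots,h_n)$. For $S\subset[n]$ with $|S|=k$ define, for $\boldsymbol\sigma\in\{-1,+1\}^n$, $$\mathbb P_S(\boldsymbol\sigma\mid\boldsymbol h)\propto\exp\Big(\frac{\theta_1}{2k}\sum_{i,j\in S}\sigma_i\sigma_j+\sum_{i=1}^n h_i\sigma_i\Big)$$ (normalized) and $\mathbb P_S(\boldsymbol\sigma)=\mathbb E_{\boldsymbol h}[\mathbb P_S(\boldsymbol\sigma\mid\boldsymbol h)]$. One observes $m$ i.i.d. samples $\boldsymbol\sigma^{(1)},\dots,\boldsymbol\sigma^{(m)}$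 from $\mathbb P_S$ (each with its own independent field). $\mathbb 1_{S'}\in\{0,1\}^n$ is the indicator vector of $S'$, $\Delta$ is the symmetric difference. Asymptotics: $k\to\infty$ with $n=n(k)\ge k$, $m=m(k)$; $\mu,\theta_1$ fixed. *)

(* Defs.v *)
From HB Require Import structures.
From mathcomp Require Export all_boot all_order all_algebra.
From mathcomp Require Export all_classical all_reals all_analysis.
Export numFieldNormedType.Exports.

Set Implicit Arguments.
Unset Strict Implicit.
Unset Printing Implicit Defensive.

Import Order.TTheory GRing.Theory Num.Theory.
Local Open Scope ring_scope.

Section Hyperbolic.
Context {R : realType}.

Definition tanh (x : R) : R := (expR x - expR (- x)) / (expR x + expR (- x)).
Definition sech (x : R) : R := 2 / (expR x + expR (- x)).

End Hyperbolic.

Section IidLaw.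
Context d (T : measurableType d) (R : realType) (mu : probability T R).

Definition cons_pair (n : nat) (x : T * n.-tuple T) : n.+1.-tuple T :=
  [tuple of x.1 :: x.2].

Lemma measurable_cons_pair (n : nat) : measurable_fun setT (@cons_pair n).
Proof. by apply: measurable_cons; [exact: measurable_fst|exact: measurable_snd]. Qed.

HB.instance Definition _ (n : nat) :=
  isMeasurableFun.Build _ _ _ _ (@cons_pair n) (@measurable_cons_pair n).

(* The n-fold product of mu, i.e. the joint law of n independent variables of
   law mu: the image of the binary product of mu and the (n-1)-fold product
   under (x, t) |-> x :: t. *)
Fixpoint iid_law (n : nat) : probability (n.-tuple T) R :=
  match n with
  | 0 => dirac [tuple]
  | n'.+1 => distribution (mu \x iid_law n')%E (@cons_pair n')
  end.

End IidLaw.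

Section PlantedRFCW.
Context {R : realType}.

(* Spin configurations; spin turns the two booleans into the values +1, -1. *)
Definition config (n : nat) := {ffun 'I_n -> bool}.

Definition spin (b : bool) : R := if b then 1 else -1.

Definition gibbs_weight (n : nat) (theta1 : R) (S : {set 'I_n})
    (h : n.-tuple R) (sigma : config n) : R :=
  expR (theta1 / (2 * #|S|%:R)
          * (\sum_(i in S) \sum_(j in S) spin (sigma i) * spin (sigma j))
        + \sum_(i < n) tnth h i * spin (sigma i)).

(* P_S(sigma | h) *)
Definition cond_pmf (n : nat) (theta1 : R) (S : {set 'I_n})
    (h : n.-tuple R) (sigma : config n) : R :=
  gibbs_weight theta1 S h sigma
    / \sum_(tau : config n) gibbs_weight theta1 S h tau.

(* P_S(sigma) *)
Definition pRFCW_pmf (mu : probability (measurableTypeR R) R) (n : nat)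
    (theta1 : R) (S : {set 'I_n}) (sigma : config n) : R :=
  fine 'E_(iid_law mu n)[fun h => cond_pmf theta1 S h sigma]%E.

(* Probability of the event A under the law of m independent samples from P_S;
   the sample space is finite, so this is the sum over A of the product pmf. *)
Definition sample_prob (mu : probability (measurableTypeR R) R) (n m : nat)
    (theta1 : R) (S : {set 'I_n}) (A : pred {ffun 'I_m -> config n}) : R :=
  \sum_(x : {ffun 'I_m -> config n} | A x)
    \prod_(i < m) pRFCW_pmf mu theta1 S (x i).

Definition spin_vec (n : nat) (sigma : config n) : 'cV[R]_n :=
  \col_i spin (sigma i).

Definition indicator_vec (n : nat) (S : {set 'I_n}) : 'cV[R]_n :=
  \col_i (i \in S)%:R.

Definition phi (n m k : nat) (x : {ffun 'I_m -> config n})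
    (S' : {set 'I_n}) : R :=
  k%:R^-1 *
  ((indicator_vec S')^T
     *m (m%:R^-1 *: \sum_(i < m) (spin_vec (x i) *m (spin_vec (x i))^T))
     *m indicator_vec S') 0 0.

(* The set of all maximizers: there may be ties. *)
Definition argmax_phi (n m k : nat) (x : {ffun 'I_m -> config n}) :
    {set {set 'I_n}} :=
  [set S' : {set 'I_n} | (#|S'| == k) &&
     [forall S'' : {set 'I_n}, (#|S''| == k) ==> (phi k x S'' <= phi k x S')]].

End PlantedRFCW.

Arguments phi R [n m] k x S'.
Arguments argmax_phi R [n m] k x.

Definition symdiff (T : finType) (A B : {set T}) : {set T} :=
  (A :\: B) :|: (B :\: A).

(* Main.v *)
From HB Require Import structures.
Require Import Defs.
From mathcomp Require Import perm ring lra measurable_realfun.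

Set Implicit Arguments.
Unset Strict Implicit.
Unset Printing Implicit Defensive.

Import Order.TTheory GRing.Theory Num.Theory.
Local Open Scope classical_set_scope.
Local Open Scope ring_scope.

(** Write [M_A] for the sum of the spins over [A] and [Y = M_S^2 / k].

    Comparison of two cliques.  For [#|S'| = k], the difference
    [phi S' - phi S] is a positive multiple of the sum over the samples of
    [M_S'^2 - M_S^2].  By the exponential Markov inequality and independence,
    [S'] beats [S] with probability at most [rho^m], where
    [rho = E exp (lam (M_S'^2 - M_S^2) / k)].  If [rho <= exp (- c)] with [c]
    independent of [k] and of every [S'] that misses a fraction of [S], the
    union bound over at most [n^k] competitors gives [n^k exp (- c m)], which
    tends to [0] as soon as [m >= (2 / c) k ln n].

    Bound on [rho] (lemma [overlap_chernoff]).  The law [P_S], averaged over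
    the field, is exchangeable on [S] because the [h_i] are i.i.d., and every
    spin outside [S] is an independent fair coin because [E tanh h = 0].  Hence,
    given [M_S], the spins on [S :&: S'] are drawn without replacement from
    those of [S], and [M_S'] is sub-Gaussian around [a M_S] with variance proxy
    about [k (1 - a^2)], where [a = #|S :&: S'| / k] (lemma [mgf_overlap]).
    Averaging the bound on [E exp (t M_S')] over a centred Gaussian [t] bounds
    [E exp (lam M_S'^2 / k)] (lemma [gaussian_mixing]), and to first order in
    [lam] this reads [rho <= 1 - lam (1 - a^2) (E min (Y, K) - 1)].  Large
    values of [Y] only help, which is why [Y] can be truncated at a constant
    [K].  What remains is that [E min (Y, K)] exceeds [1] by a constant.

    Excess of the second moment (lemma [law_trunc_mean_ge]).  Given [h], the
    law is the product law with means [tanh h_i], tilted by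
    [exp (theta1 Y / 2)].  This weight increases in [Y], so by Chebyshev's
    association inequality it raises the mean of [f = min (Y, K)] at least as
    much as the weight [1 + (theta1 / 2) f], that is, by at least
    [Var f / (2 K)] when [K >= 2 / theta1].  Averaged over [h], the untilted
    product law is uniform, so [E Y = 1] and [E Y^3 <= 15], and truncation costs
    [O (K^-2)].  The variance of [Y] given [h] has average
    [2 (1 - 1 / k) (1 - tau^2)] with [tau = E tanh^2 h < 1], so the gain is of
    order [1 / K] and wins for large [K]. *)

(** * The two-point moment generating function and Gaussian averaging *)

Lemma nondecreasing_of_derive_ge0 (R : realType) (f df : R -> R) (a b : R) :
  a <= b -> (forall x : R, is_derive x 1 f (df x)) ->
  (forall x, a <= x -> 0 <= df x) -> f a <= f b.
Proof.
move=> ab fD df0.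
have cf : {within `[a, b], continuous f}.
  apply: continuous_subspaceT => x; apply: differentiable_continuous.
  by apply/derivable1_diffP; apply: ex_derive.
have [c /[!in_itv]/= /andP[ac _]] := MVT_segment ab (fun x _ => fD x) cf.
move=> E; rewrite -subr_ge0 E mulr_ge0 ?subr_ge0//; exact: df0.
Qed.

Section two_point.
Context {R : realType}.

(** Hoeffding's lemma for a spin of mean [m], with the sharp constant.  The log of
    the left-hand side has second derivative [1 - (N / D)^2 <= 1] in [c] and
    agrees with the right-hand side to first order at [0]. *)
Lemma two_point_mgf_le_ge0 (c m : R) : 0 <= c -> -1 <= m <= 1 ->
  (1 + m) / 2 * expR c + (1 - m) / 2 * expR (- c) <= expR (c * m + c ^+ 2 / 2).
Proof.
move=> c0 /andP[m1 m2].
pose p := (1 + m) / 2; pose q := (1 - m) / 2.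
have p0 : 0 <= p by rewrite /p; lra.
have q0 : 0 <= q by rewrite /q; lra.
have pq : p + q = 1 by rewrite /p /q; lra.
pose D := fun x : R => p * expR x + q * expR (- x).
(* [D] is the moment generating function, [N] its derivative, and [N' = D]. *)
pose N := fun x : R => p * expR x - q * expR (- x).
have Dgt0 x : 0 < D x.
  rewrite /D; have := expR_gt0 x; have := expR_gt0 (- x) => e1 e2.
  have [p00|pp] := eqVneq p 0.
    have q1 : q = 1 by move: pq; rewrite p00 add0r.
    by rewrite p00 q1 mul0r add0r mul1r.
  apply: ltr_pwDl; last by rewrite mulr_ge0 ?(ltW e1).
  by apply: mulr_gt0 => //; rewrite lt0r pp.
have eD (x : R) : is_derive x 1 (fun y : R => expR (- y)) (- expR (- x)).
  by apply: is_derive_eq; rewrite /GRing.scale/=; ring.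
have dD (x : R) : is_derive x 1 D (N x).
  rewrite /D /N; apply: is_derive_eq; rewrite /GRing.scale/=; lra.
have dN (x : R) : is_derive x 1 N (D x).
  rewrite /D /N; apply: is_derive_eq; rewrite /GRing.scale/=; lra.
pose G := fun x : R => m + x - N x / D x.
have dG (x : R) : is_derive x 1 G ((N x / D x) ^+ 2).
  have Dx : D x != 0 by rewrite gt_eqF.
  have iV := is_deriveV Dx (dD x).
  rewrite /G; apply: is_derive_eq; rewrite /GRing.scale/=; by field.
have G0 : G 0 = 0.
  by rewrite /G /N /D oppr0 expR0 !mulr1 pq divr1 addr0 /p /q; lra.
have Gge0 x : 0 <= x -> 0 <= G x.
  move=> x0; rewrite -G0; apply: (nondecreasing_of_derive_ge0 x0 dG) => y _.
  exact: sqr_ge0.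
pose F := fun x : R => m * x + x ^+ 2 / 2 - ln (D x).
have dF (x : R) : is_derive x 1 F (G x).
  have il := is_derive1_comp (is_derive1_ln (Dgt0 x)) (dD x).
  rewrite /F /G; apply: is_derive_eq; rewrite /GRing.scale/=.
  set u := D x; set v := N x; have u0 : u != 0 by rewrite gt_eqF ?Dgt0.
  by field.
have F0 : F 0 = 0 by rewrite /F /D oppr0 expR0 !mulr1 pq ln1; lra.
have := nondecreasing_of_derive_ge0 c0 dF Gge0.
rewrite F0 /F subr_ge0 -ler_expR lnK; last exact: Dgt0.
by rewrite /D /p /q (mulrC m).
Qed.

Lemma two_point_mgf_le (c m : R) : -1 <= m <= 1 ->
  (1 + m) / 2 * expR c + (1 - m) / 2 * expR (- c) <= expR (c * m + c ^+ 2 / 2).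
Proof.
move=> mb; have [c0|/ltW c0] := leP 0 c; first exact: two_point_mgf_le_ge0.
have := @two_point_mgf_le_ge0 (- c) (- m).
rewrite oppr_ge0 !opprK sqrrN mulrNN addrC; apply=> //.
by rewrite lerN2 lerNl andbC.
Qed.

End two_point.

Section gaussian_mixing.
Context {R : realType}.
Let leb := @lebesgue_measure R.

Lemma integral_normal_mixture (I : finType) (w mean : I -> R) (s : R) :
  (forall i, 0 <= w i) ->
  (\int[leb]_t (\sum_i w i * normal_pdf (mean i) s t)%:E = (\sum_i w i)%:E)%E.
Proof.
move=> w0; under eq_integral do rewrite -sumEFin.
rewrite ge0_integral_sum//; first last.
- by move=> i t _; rewrite lee_fin mulr_ge0// normal_pdf_ge0.
- move=> i; apply/measurable_EFinP; apply: measurable_funM => //.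
  exact: measurable_normal_pdf.
rewrite -sumEFin; apply: eq_bigr => i _.
under eq_integral do rewrite EFinM.
rewrite ge0_integralZl//.
- by rewrite integral_normal_pdf mule1.
- by apply/measurable_EFinP; exact: measurable_normal_pdf.
- by move=> t _; rewrite lee_fin normal_pdf_ge0.
- by rewrite lee_fin.
Qed.

Lemma normal_pdf_sqrtE (m s t : R) : 0 < s ->
  normal_pdf m (Num.sqrt s) t
  = (Num.sqrt (s * pi *+ 2))^-1 * expR (- (t - m) ^+ 2 / (s *+ 2)).
Proof.
move=> s0; rewrite normal_pdfE ?gt_eqF ?sqrtr_gt0//.
by rewrite /normal_peak /normal_fun sqr_sqrtr ?ltW.
Qed.

(** Completing the square: tilting a centred Gaussian density by
    [exp (t x + t^2 v / 2)] gives a multiple of another Gaussian density. *)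
Lemma normal_tilt (s v x t : R) : 0 < s -> s * v < 1 ->
  expR (t * x + t ^+ 2 * v / 2) * normal_pdf 0 (Num.sqrt s) t
  = (Num.sqrt (1 - s * v))^-1 * expR (s * x ^+ 2 / (2 * (1 - s * v)))
    * normal_pdf (s / (1 - s * v) * x) (Num.sqrt (s / (1 - s * v))) t.
Proof.
move=> s0 sv; have d0 : 0 < 1 - s * v by rewrite subr_gt0.
rewrite !normal_pdf_sqrtE ?divr_gt0//.
rewrite mulrCA -expRD [RHS]mulrACA -expRD; congr (_ * expR _); last first.
  by field; rewrite !gt_eqF.
rewrite -invfM -sqrtrM ?ltW//; congr (Num.sqrt _)^-1.
by field; rewrite gt_eqF.
Qed.

(** The identity [exp (s x^2 / 2) = E exp (t x)] for [t] Gaussian of variance [s]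
    transfers a comparison of exponentials to a comparison of exponentials of
    squares.  The factor [(1 - s v)^(-1/2)] is the Gaussian integral of the
    term [t^2 v / 2]. *)
Lemma gaussian_mixing (I : finType) (w x y : I -> R) (v s : R) :
  (forall i, 0 <= w i) -> 0 < s -> s * v < 1 ->
  (forall t, \sum_i w i * expR (t * x i)
             <= \sum_i w i * expR (t * y i + t ^+ 2 * v / 2)) ->
  \sum_i w i * expR (s * x i ^+ 2 / 2)
  <= (Num.sqrt (1 - s * v))^-1
     * \sum_i w i * expR (s * y i ^+ 2 / (2 * (1 - s * v))).
Proof.
move=> w0 s0 sv H; have d0 : 0 < 1 - s * v by rewrite subr_gt0.
pose g0 t := normal_pdf 0 (Num.sqrt s) t.
rewrite mulr_sumr -lee_fin.
under [X in (_ <= (X)%:E)%E]eq_bigr do rewrite mulrCA.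
rewrite -(integral_normal_mixture (fun i => s * x i) (Num.sqrt s)); last first.
  by move=> i; rewrite mulr_ge0 ?expR_ge0.
rewrite -(integral_normal_mixture (fun i => s / (1 - s * v) * y i)
  (Num.sqrt (s / (1 - s * v)))); last first.
  by move=> i; rewrite !mulr_ge0 ?invr_ge0 ?sqrtr_ge0 ?expR_ge0.
(* With [v = 0] the tilt leaves the variance unchanged. *)
have E1 t : \sum_i w i * expR (s * x i ^+ 2 / 2)
    * normal_pdf (s * x i) (Num.sqrt s) t
    = (\sum_i w i * expR (t * x i)) * g0 t.
  rewrite mulr_suml; apply: eq_bigr => i _; rewrite -mulrA -[RHS]mulrA; congr (_ * _).
  have := @normal_tilt s 0 (x i) t s0; rewrite mulr0 => /(_ ltr01).
  by rewrite !mulr0 !subr0 sqrtr1 mul0r !invr1 mul1r !mulr1 addr0 => ->.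
have E2 t : \sum_i w i * ((Num.sqrt (1 - s * v))^-1 *
        expR (s * y i ^+ 2 / (2 * (1 - s * v))))
    * normal_pdf (s / (1 - s * v) * y i) (Num.sqrt (s / (1 - s * v))) t
    = (\sum_i w i * expR (t * y i + t ^+ 2 * v / 2)) * g0 t.
  rewrite mulr_suml; apply: eq_bigr => i _; rewrite -mulrA -[RHS]mulrA; congr (_ * _).
  by rewrite -normal_tilt.
have mN a b : measurable_fun setT (fun t : R => normal_pdf a b t).
  exact: measurable_normal_pdf.
apply: ge0_le_integral => //.
- move=> t _; rewrite lee_fin sumr_ge0// => i _.
  by rewrite !mulr_ge0 ?expR_ge0 ?normal_pdf_ge0.
- apply/measurable_EFinP; apply: measurable_sum => i.
  by apply: measurable_funM => //; exact: mN.
- apply/measurable_EFinP; apply: measurable_sum => i.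
  by apply: measurable_funM => //; exact: mN.
- by move=> t _; rewrite lee_fin E1 E2 ler_wpM2r ?normal_pdf_ge0.
Qed.

End gaussian_mixing.

(** * Spin sums under exchangeable weights *)

Section spins.
Context {R : realType}.
Variable n : nat.
Implicit Types (s : config n) (A B S : {set 'I_n}) (W : config n -> R).

Definition magn A s : R := \sum_(i in A) spin (s i).
Definition flip (i : 'I_n) s : config n :=
  [ffun j => if j == i then ~~ s j else s j].
Definition swap_sites (i j : 'I_n) s : config n := [ffun l => s (tperm i j l)].

Lemma spin_negb b : spin (~~ b) = - spin b :> R.
Proof. by case: b; rewrite /spin//= opprK. Qed.

Lemma sqr_spin b : spin b ^+ 2 = 1 :> R.
Proof. by case: b; rewrite /spin/= ?sqrrN expr1n. Qed.

Lemma spin_bound b : -1 <= (spin b : R) <= 1.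
Proof. by case: b; rewrite /spin; apply/andP; split; lra. Qed.

Lemma flipK i : involutive (flip i).
Proof. by move=> s; apply/ffunP => j; rewrite !ffunE; case: eqP; rewrite ?negbK. Qed.

Lemma swap_sitesK i j : involutive (swap_sites i j).
Proof. by move=> s; apply/ffunP => l; rewrite !ffunE tpermK. Qed.

Lemma sum_flip i (F : config n -> R) : \sum_s F (flip i s) = \sum_s F s.
Proof. by rewrite [RHS](reindex_inj (inv_inj (flipK i))). Qed.

Lemma sum_swap i j (F : config n -> R) : \sum_s F (swap_sites i j s) = \sum_s F s.
Proof. by rewrite [RHS](reindex_inj (inv_inj (swap_sitesK i j))). Qed.

Lemma magn_flip A i s : i \notin A -> magn A (flip i s) = magn A s.
Proof.
move=> iA; apply: eq_bigr => j jA; rewrite ffunE; case: eqP => // ji.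
by rewrite -ji jA in iA.
Qed.

Lemma magn_swap A i j s : i \in A -> j \in A ->
  magn A (swap_sites i j s) = magn A s.
Proof.
move=> iA jA; rewrite /magn [RHS](reindex_inj (@perm_inj _ (tperm i j)))/=.
apply: eq_big => [l|l _]; last by rewrite ffunE.
by case: tpermP => [->|->|//]; rewrite ?iA ?jA.
Qed.

Lemma magnD1 A i s : i \in A -> magn A s = spin (s i) + magn (A :\ i) s.
Proof.
move=> iA; rewrite /magn (big_setD1 i)//=.
Qed.

Lemma magn_bound A s : - #|A|%:R <= magn A s <= #|A|%:R.
Proof.
rewrite -sumr_const -sumrN; apply/andP; split; apply: ler_sum => i _;
by have /andP[] := spin_bound (s i).
Qed.

(** The exponential of a spin is affine in the spin, so a mean of such exponentials
    depends on the spins only through their mean. *)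
Lemma expR_spin (c : R) b :
  expR (c * spin b) = (1 + spin b) / 2 * expR c + (1 - spin b) / 2 * expR (- c).
Proof. by case: b; rewrite /spin ?mulr1 ?mulrN1; lra. Qed.

Definition exchangeable S W :=
  forall i j s, i \in S -> j \in S -> W (swap_sites i j s) = W s.

Definition flip_invariant i W := forall s, W (flip i s) = W s.

(** A spin whose flip preserves the weight is a fair coin, and [cosh t] is at most
    [exp (t^2 / 2)]. *)
Lemma mgf_outside B W (t : R) : (forall s, 0 <= W s) ->
  (forall i, i \in B -> flip_invariant i W) ->
  \sum_s W s * expR (t * magn B s) <= expR (t ^+ 2 * #|B|%:R / 2) * \sum_s W s.
Proof.
elim: {B}#|B| {-2}B (erefl #|B|) W => [|b IH] B Bb W W0 fW.
  have -> : B = finset.set0 by apply/eqP; rewrite -cards_eq0 Bb.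
  rewrite cards0 mulr0 mul0r expR0 mul1r.
  by apply: ler_sum => s _; rewrite /magn big_set0 mulr0 expR0 mulr1.
have [i iB] : exists i, i \in B by apply/set0Pn; rewrite -cards_eq0 Bb.
have Bb' : #|B :\ i| = b by move: Bb; rewrite (cardsD1 i) iB => -[].
have E s : W s * expR (t * magn B s)
    = W s * expR (t * magn (B :\ i) s) * expR (t * spin (s i)).
  by rewrite (magnD1 _ iB) mulrDr expRD; ring.
under eq_bigr do rewrite E.
have -> : \sum_s W s * expR (t * magn (B :\ i) s) * expR (t * spin (s i))
   = (expR t + expR (- t)) / 2 * \sum_s W s * expR (t * magn (B :\ i) s).
  set F := (X in _ = _ * \sum_s X s).
  have FF s : F (flip i s) = F s by rewrite /F fW// magn_flip// !inE eqxx.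
  set X := LHS; set Y := \sum_s _.
  suff : X + X = (expR t + expR (- t)) * Y by move=> ?; lra.
  rewrite /X -{2}(sum_flip i) -big_split/= mulr_sumr.
  apply: eq_bigr => s _; rewrite -/(F s) -/(F (flip i s)) FF !ffunE eqxx spin_negb.
  by case: (s i); rewrite /spin ?mulrN ?mulr1 ?opprK; ring.
have H0 : (expR t + expR (- t)) / 2 <= expR (t ^+ 2 / 2).
  by have := @two_point_mgf_le R t 0; rewrite mulr0 add0r; lra.
apply: (@le_trans _ _ (expR (t ^+ 2 / 2) *
    \sum_s W s * expR (t * magn (B :\ i) s))).
  by apply: ler_wpM2r => //; apply: sumr_ge0 => s _; rewrite mulr_ge0 ?expR_ge0.
apply: (@le_trans _ _ (expR (t ^+ 2 / 2) *
    (expR (t ^+ 2 * b%:R / 2) * \sum_s W s))).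
  apply: ler_wpM2l; first exact: expR_ge0.
  rewrite -Bb'; apply: IH => // j; rewrite inE => /andP[_ jB]; exact: fW.
rewrite mulrA -expRD Bb; apply: ler_wpM2r; first exact: sumr_ge0.
by rewrite ler_expR -natr1; lra.
Qed.

(** By exchangeability one spin of [S] may be replaced by the average over [S]; the
    empirical law of the spins of [S] has mean [magn S / #|S|], and the two-point
    bound applies to it. *)
Lemma mgf_single S W (c : R) i : (forall s, 0 <= W s) -> exchangeable S W ->
  i \in S ->
  \sum_s W s * expR (c * spin (s i))
  <= \sum_s W s * expR (c * (magn S s / #|S|%:R) + c ^+ 2 / 2).
Proof.
move=> W0 eW iS.
have k0 : (0 : R) < #|S|%:R by rewrite ltr0n card_gt0; apply/set0Pn; exists i.
have sw j : j \in S ->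
    \sum_s W s * expR (c * spin (s j)) = \sum_s W s * expR (c * spin (s i)).
  move=> jS; rewrite -(sum_swap i j); apply: eq_bigr => s _.
  by rewrite eW// ffunE tpermR.
rewrite -(ler_pM2l k0) [leLHS]mulr_natl -sumr_const.
under eq_bigr => j jS do rewrite -(sw j jS).
rewrite exchange_big/= mulr_sumr; apply: ler_sum => s _.
rewrite -mulr_sumr mulrCA; apply: ler_wpM2l => //.
under eq_bigr do rewrite expR_spin.
have -> : \sum_(j in S) ((1 + spin (s j)) / 2 * expR c
      + (1 - spin (s j)) / 2 * expR (- c))
   = #|S|%:R * ((1 + magn S s / #|S|%:R) / 2 * expR c
      + (1 - magn S s / #|S|%:R) / 2 * expR (- c)).
  rewrite big_split/= -!mulr_suml big_split/= sumrB sumr_const -/(magn S s).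
  by field; rewrite gt_eqF.
rewrite ler_pM2l//; apply: two_point_mgf_le.
by rewrite ler_pdivlMr// ler_pdivrMr// mul1r mulN1r magn_bound.
Qed.

(** Serfling's variance proxy for the sum of [l] draws without replacement from a
    population of [k] spins. *)
Definition serfling (k l : nat) : R := l%:R * (k%:R - l%:R + 1) / k%:R.

(** The two sides differ by [l (k - l) / (k^2 (k + 1))]. *)
Lemma serfling_step (k l : nat) : (l <= k)%N ->
  serfling k l + (1 - l%:R / k%:R) ^+ 2 <= serfling k.+1 l.+1.
Proof.
rewrite /serfling => lk; have [k0|k0] := posnP k.
  move: lk; rewrite k0 leqn0 => /eqP ->.
  by rewrite !invr0 !mulr0 add0r subr0 expr1n subrr add0r invr1 !mulr1.
rewrite -subr_ge0.
have -> : l.+1%:R * (k.+1%:R - l.+1%:R + 1) / k.+1%:R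
  - (l%:R * (k%:R - l%:R + 1) / k%:R + (1 - l%:R / k%:R) ^+ 2)
  = (k%:R - l%:R) * l%:R / (k%:R ^+ 2 * k.+1%:R) :> R.
  by rewrite -!natr1; field; rewrite natr1 !pnatr_eq0/= -lt0n k0.
by rewrite !mulr_ge0// ?subr_ge0 ?ler_nat// invr_ge0 mulr_ge0// exprn_ge0.
Qed.

(** Sampling without replacement: the spins on [A] are exposed one at a time.
    Fixing the spin at [i] leaves the weight exchangeable on [S :\ i], and the
    remaining draws are centred at a multiple of [magn (S :\ i)].  The
    finite-population factor in [serfling] matters: without it the proxy in
    [mgf_overlap] would be [k], and the first-order gain would be lost. *)
Lemma mgf_inside S A W (t : R) : (forall s, 0 <= W s) -> exchangeable S W ->
  A \subset S ->
  \sum_s W s * expR (t * magn A s)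
  <= \sum_s W s * expR (t * (#|A|%:R / #|S|%:R * magn S s)
                        + t ^+ 2 * serfling #|S| #|A| / 2).
Proof.
elim: {A}#|A| {-2}A (erefl #|A|) S W => [|l IH] A Al S W W0 eW AS.
  have -> : A = finset.set0 by apply/eqP; rewrite -cards_eq0 Al.
  rewrite /serfling cards0.
  apply: ler_sum => s _; rewrite /magn big_set0 !(mul0r,mulr0) addr0//.
have [i iA] : exists i, i \in A by apply/set0Pn; rewrite -cards_eq0 Al.
have iS := fintype.subsetP AS i iA.
have Al' : #|A :\ i| = l by move: Al; rewrite (cardsD1 i) iA => -[].
have [k Sk] : exists k, #|S| = k.+1 by exists #|S :\ i|; rewrite (cardsD1 i) iS.
have Sk' : #|S :\ i| = k by move: Sk; rewrite (cardsD1 i) iS => -[].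
have lk : (l <= k)%N by rewrite -Al' -Sk'; apply: subset_leq_card; exact: finset.setSD.
have [a aE] : exists a : R, a = l%:R / k%:R by exists (l%:R / k%:R).
pose W1 s := W s * expR (t * spin (s i)).
have E1 s : W s * expR (t * magn A s) = W1 s * expR (t * magn (A :\ i) s).
  by rewrite (magnD1 _ iA) mulrDr expRD mulrA.
under eq_bigr do rewrite E1.
apply: le_trans (IH (A :\ i) Al' (S :\ i) W1 _ _ _) _.
- by move=> s; rewrite mulr_ge0 ?expR_ge0.
- move=> j j' s; rewrite !inE => /andP[ji jS] /andP[ji' jS'].
  by rewrite /W1 eW// ffunE tpermD.
- exact: finset.setSD.
rewrite Al' Sk' Sk Al -aE.
pose c := t * (1 - a).
(* Rewriting [magn (S :\ i)] through [magn S] leaves the spin at [i] with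
   the reduced coefficient [c]. *)
pose W2 s := W s * expR (t * (a * magn S s) + t ^+ 2 * serfling k l / 2).
have E2 s : W1 s * expR (t * (a * magn (S :\ i) s) + t ^+ 2 * serfling k l / 2)
    = W2 s * expR (c * spin (s i)).
  rewrite /W1 /W2 (magnD1 _ iS) -!mulrA -!expRD; congr (_ * expR _).
  by rewrite /c; ring.
under eq_bigr do rewrite E2.
apply: le_trans (@mgf_single S W2 c i _ _ iS) _.
- by move=> s; rewrite mulr_ge0 ?expR_ge0.
- by move=> j j' s jS jS'; rewrite /W2 eW// magn_swap.
apply: ler_sum => s _; rewrite /W2 -mulrA -expRD; apply: ler_wpM2l => //.
rewrite ler_expR Sk.
(* When [k = 0] both sides are read with [0 / 0 = 0], and [l = 0]. *)
have ea : a + (1 - a) / k.+1%:R = l.+1%:R / k.+1%:R.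
  rewrite aE; have [k0|k0] := posnP k.
    move: lk; rewrite k0 leqn0 => /eqP ->.
    by rewrite invr0 mulr0 subr0 add0r.
  by rewrite -!natr1; field; rewrite natr1 !pnatr_eq0/= -lt0n k0.
rewrite -ea; have := serfling_step lk; rewrite -aE => st.
have t2 : 0 <= t ^+ 2 by exact: sqr_ge0.
move: (ler_wpM2l t2 st); rewrite /c.
by move: (serfling k l) (serfling _ _) (magn S s) (k.+1%:R^-1) => u v M r; lra.
Qed.

(** The competitor splits into [S :&: S'], drawn without replacement from [S], and
    [S' :\: S], made of fair coins.  With [l = #|S :&: S'|] the total proxy is
    about [k - l^2 / k], smaller than [k]: this is what makes the estimate
    sharp at first order. *)
Lemma mgf_overlap S S' W (t : R) : (forall s, 0 <= W s) -> exchangeable S W ->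
  (forall i, i \notin S -> flip_invariant i W) -> #|S'| = #|S| ->
  \sum_s W s * expR (t * magn S' s)
  <= \sum_s W s * expR (t * (#|S :&: S'|%:R / #|S|%:R * magn S s)
     + t ^+ 2 * (serfling #|S| #|S :&: S'| + #|S|%:R - #|S :&: S'|%:R) / 2).
Proof.
move=> W0 eW fW cS; set l := #|S :&: S'|.
have cB : #|S' :\: S|%:R = #|S|%:R - l%:R :> R.
  by rewrite -cS /l finset.setIC -natrB ?subset_leq_card ?finset.subsetIl// cardsD.
pose W1 s := W s * expR (t * magn (S :&: S') s).
have E1 s : W s * expR (t * magn S' s) = W1 s * expR (t * magn (S' :\: S) s).
  by rewrite /W1 -mulrA -expRD -mulrDr /magn (big_setID S)/= finset.setIC.
under eq_bigr do rewrite E1.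
apply: le_trans (@mgf_outside (S' :\: S) W1 t _ _) _.
- by move=> s; rewrite mulr_ge0 ?expR_ge0.
- move=> i; rewrite inE => /andP[iS _] s; rewrite /W1 fW//.
  by rewrite magn_flip// inE negb_and iS.
apply: le_trans (ler_wpM2l (expR_ge0 _) (@mgf_inside S (S :&: S') W t W0 eW _)) _.
  exact: finset.subsetIl.
rewrite mulr_sumr; apply: ler_sum => s _; rewrite mulrCA -expRD.
by apply: ler_wpM2l => //; rewrite ler_expR cB -/l; lra.
Qed.

End spins.

(** * The Chernoff factor of a competing clique *)

Section scalar.
Context {R : realType}.

Lemma expR_le_quadratic (y : R) : y <= 1 / 2 -> expR y <= 1 + y + 2 * y ^+ 2.
Proof.
move=> y2; have y1 : 0 < 1 - y by lra.
have h : expR y <= (1 - y)^-1.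
  rewrite -[y in leLHS]opprK expRN lef_pV2 ?posrE ?expR_gt0//.
  exact: expR_ge1Dx.
apply: (le_trans h); rewrite -div1r ler_pdivrMr//.
have := sqr_ge0 y => y0; have : 0 <= y ^+ 2 * (1 - 2 * y) by rewrite mulr_ge0//; lra.
by lra.
Qed.

(** With [x = 2 u], this is the square root of
    [1 / (1 - x) = 1 + x / (1 - x) <= exp (x / (1 - x))]. *)
Lemma inv_sqrt_le_expR (u : R) : u < 1 / 2 ->
  (Num.sqrt (1 - 2 * u))^-1 <= expR (u / (1 - 2 * u)).
Proof.
move=> u2; have d0 : 0 < 1 - 2 * u by lra.
rewrite -ler_sqr ?nnegrE ?invr_ge0 ?sqrtr_ge0 ?expR_ge0//.
rewrite exprVn sqr_sqrtr ?(ltW d0)// -expRM_natl.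
apply: le_trans (expR_ge1Dx _).
by rewrite le_eqVlt; apply/orP; left; apply/eqP; field; rewrite gt_eqF.
Qed.

(** The exponent produced by Gaussian averaging, to second order in [lam].  The
    net coefficient of [Y] is at most [- lam (1 - a^2 - 8 lam) <= 0], so [Y] may
    be replaced by any smaller [f]. *)
Lemma chernoff_exponent_le (a k1 lam u Y f K : R) :
  0 <= a <= 1 -> 0 <= k1 <= 1 -> 0 < lam -> 8 * lam <= 1 - a ^+ 2 ->
  0 <= f -> f <= Y -> f <= K ->
  u = lam * (1 - a ^+ 2 + a * k1) ->
  u / (1 - 2 * u) - lam * Y + lam * a ^+ 2 * Y / (1 - 2 * u)
  <= - lam * (1 - a ^+ 2) * (f - 1) + lam * k1 + 8 * lam ^+ 2 * K + 16 * lam ^+ 2.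
Proof.
move=> /andP[a0 a1] /andP[k0 k2] l0 lq f0 fY fK uE.
have ak : a * k1 <= k1 by rewrite ler_piMl.
have ak0 : 0 <= a * k1 by rewrite mulr_ge0.
have a20 : 0 <= a ^+ 2 by rewrite sqr_ge0.
have u0 : 0 <= u by rewrite uE mulr_ge0 ?(ltW l0)//; lra.
have u1 : u <= lam * (1 - a ^+ 2 + k1) by rewrite uE ler_pM2l//; lra.
have u2 : u <= 2 * lam by apply: (le_trans u1); rewrite mulrC ler_pM2r//; lra.
(* On this range [1 / (1 - 2 u) <= 1 + 4 u]. *)
have u4 : u <= 1 / 4 by lra.
have d0 : 0 < 1 - 2 * u by lra.
have rE : (1 - 2 * u)^-1 <= 1 + 4 * u.
  rewrite -div1r ler_pdivrMr//.
  have : 0 <= u * (1 - 4 * u) by rewrite mulr_ge0//; lra.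
  by lra.
set r := (1 - 2 * u)^-1 in rE *.
have h1 : u * r <= lam * (1 - a ^+ 2 + k1) + 16 * lam ^+ 2.
  apply: (@le_trans _ _ (u * (1 + 4 * u))); first by rewrite ler_wpM2l.
  have : u ^+ 2 <= (2 * lam) ^+ 2 by rewrite ler_sqr ?nnegrE//; lra.
  by lra.
have h2 : a ^+ 2 * r <= a ^+ 2 + 8 * lam.
  apply: (@le_trans _ _ (a ^+ 2 * (1 + 4 * u))); first by rewrite ler_wpM2l.
  have : a ^+ 2 * u <= u by rewrite ler_piMl//; nra.
  by lra.
have Y0 : 0 <= Y by lra.
have h3 : lam * Y * (a ^+ 2 * r) <= lam * Y * (a ^+ 2 + 8 * lam).
  by rewrite ler_wpM2l// mulr_ge0// ltW.
have h4 : lam * f * (1 - a ^+ 2 - 8 * lam) <= lam * Y * (1 - a ^+ 2 - 8 * lam).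
  by rewrite ler_wpM2r ?ler_pM2l//; lra.
have h5 : lam ^+ 2 * f <= lam ^+ 2 * K by rewrite ler_wpM2l ?sqr_ge0.
by lra.
Qed.

End scalar.

Section overlap.
Context {R : realType}.
Variable n : nat.
Implicit Types (s : config n) (S : {set 'I_n}) (P : config n -> R).

(** The exponential moment of [M_S'^2 - M_S^2] is below [1] by a constant, as soon
    as the truncated second moment of [M_S / sqrt k] exceeds [1] by [c].  The
    value of [lam] is such that the second-order terms, of size
    [lam^2 (K + 1)^2], and the term [lam / k] together consume at most half of
    the first-order gain [lam q0 c]. *)
Lemma overlap_chernoff P S (S' : {set 'I_n}) (K c q0 lam : R) :
  (forall s, 0 <= P s) -> \sum_s P s = 1 -> exchangeable S P ->
  (forall i, i \notin S -> flip_invariant i P) ->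
  (0 < #|S|)%N -> #|S'| = #|S| ->
  0 < c -> 0 < K ->
  1 + c <= \sum_s P s * Num.min (magn S s ^+ 2 / #|S|%:R) K ->
  0 < q0 <= 1 - (#|S :&: S'|%:R / #|S|%:R) ^+ 2 ->
  (#|S|%:R)^-1 <= q0 * c / 4 ->
  lam = q0 * c / (160 * (K + 1) ^+ 2) ->
  \sum_s P s * expR (lam * ((magn S' s ^+ 2 - magn S s ^+ 2) / #|S|%:R))
  <= 1 - lam * q0 * c / 2.
Proof.
move=> P0 P1 eP fP S0 cS c0 K0 Ef /andP[q00 q0a] kc lamD.
set k : R := #|S|%:R in Ef q0a kc *; set l : R := #|S :&: S'|%:R in q0a *.
have k0 : 0 < k by rewrite ltr0n.
have k1 : 1 <= k by rewrite ler1n.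
have l0 : 0 <= l by [].
have lk : l <= k by rewrite ler_nat subset_leq_card ?finset.subsetIl.
set a := l / k in q0a *.
have a0 : 0 <= a by rewrite divr_ge0// ltW.
have a1 : a <= 1 by rewrite ler_pdivrMr// mul1r.
pose f s := Num.min (magn S s ^+ 2 / k) K.
have Y0 s : 0 <= magn S s ^+ 2 / k by rewrite divr_ge0 ?sqr_ge0 ?ltW.
have f0 s : 0 <= f s by rewrite /f le_min Y0 ltW.
have fK s : f s <= K by rewrite /f ge_min lexx orbT.
have fY s : f s <= magn S s ^+ 2 / k by rewrite /f ge_min lexx.
have cK : c <= K + 1.
  have : \sum_s P s * f s <= K.
    rewrite -[leRHS]mul1r -P1 mulr_suml; apply: ler_sum => s _.
    by rewrite ler_wpM2l.
  by move=> h; move: Ef h; rewrite -/f; lra.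
have q01 : q0 <= 1 by have := sqr_ge0 a; lra.
have K1 : 1 <= K + 1 by lra.
have D0 : 0 < 160 * (K + 1) ^+ 2 by rewrite mulr_gt0// exprn_gt0//; lra.
have lam0 : 0 < lam by rewrite lamD !mulr_gt0// invr_gt0.
have lamE : lam * (160 * (K + 1) ^+ 2) = q0 * c.
  by rewrite lamD divfK// gt_eqF.
have lamK : lam * (K + 1) <= q0 / 160.
  have : 160 * (lam * (K + 1)) * (K + 1) <= q0 * (K + 1).
    have -> : 160 * (lam * (K + 1)) * (K + 1) = q0 * c by rewrite -lamE; ring.
    by rewrite ler_pM2l.
  by rewrite ler_pM2r//; lra.
have lamq : lam <= q0 / 160.
  apply: le_trans lamK; rewrite ler_peMr//; exact: ltW.
have ki0 : 0 < k^-1 by rewrite invr_gt0.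
have ki1 : k^-1 <= 1 by rewrite invf_le1.
(* The factor [exp (- lam M_S^2 / k)] is exchangeable on [S] and can be
   absorbed in the weight. *)
pose W s := P s * expR (- lam * (magn S s ^+ 2 / k)).
have W0 s : 0 <= W s by rewrite mulr_ge0 ?expR_ge0.
have eW : exchangeable S W by move=> i j s iS jS; rewrite /W eP// magn_swap.
have fW i : i \notin S -> flip_invariant i W.
  by move=> iS s; rewrite /W fP// magn_flip.
pose v : R := serfling #|S| #|S :&: S'| + k - l.
pose u := lam * (1 - a ^+ 2 + a * k^-1).
have uE : 2 * lam / k * v = 2 * u.
  rewrite /u /v /serfling -/k -/l /a; field; rewrite gt_eqF//.
have u2 : 2 * u < 1.
  have : a * k^-1 <= 1 by rewrite mulr_ile1 // ltW.
  have a20 := sqr_ge0 a.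
  move=> h; have : u <= lam * 2 by rewrite /u ler_pM2l//; lra.
  by lra.
have lk0 : 0 < 2 * lam / k by rewrite divr_gt0// mulr_gt0.
have H := @gaussian_mixing R (config n) W (magn S') (fun s => a * magn S s) v
  (2 * lam / k) W0 lk0.
rewrite uE in H; have {}H := H u2 (fun t => mgf_overlap t W0 eW fW cS).
have -> : \sum_s P s * expR (lam * ((magn S' s ^+ 2 - magn S s ^+ 2) / k))
    = \sum_s W s * expR (2 * lam / k * magn S' s ^+ 2 / 2).
  apply: eq_bigr => s _; rewrite /W -mulrA -expRD; congr (_ * expR _).
  by field; rewrite gt_eqF.
apply: le_trans H _.
(* [y] lies between [- 1 / 2] and [1 / 2], so its exponential can be expanded. *)
pose y s := - lam * (1 - a ^+ 2) * (f s - 1) + lam * k^-1 + 8 * lam ^+ 2 * K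
  + 16 * lam ^+ 2.
apply: (@le_trans _ _ (\sum_s P s * expR (y s))).
  rewrite mulr_sumr; apply: ler_sum => s _.
  rewrite /W mulrCA -[leLHS]mulrA ler_wpM2l//.
  apply: (@le_trans _ _ (expR (u / (1 - 2 * u)) * (expR (- lam * (magn S s ^+ 2 / k)) *
      expR (2 * lam / k * (a * magn S s) ^+ 2 / (2 * (1 - 2 * u)))))).
    rewrite mulrCA; apply: ler_wpM2r; last by apply: inv_sqrt_le_expR; lra.
    by rewrite mulr_ge0 ?expR_ge0.
  rewrite -!expRD ler_expR.
  have lq : 8 * lam <= 1 - a ^+ 2 by lra.
  have := @chernoff_exponent_le R a k^-1 lam u _ _ K _ _ lam0 lq
    (f0 s) (fY s) (fK s) erefl.
  rewrite a0 a1 ki1 ltW// => /(_ isT isT); apply: le_trans.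
  rewrite le_eqVlt; apply/orP; left; apply/eqP; rewrite -/u.
  by field; rewrite !gt_eqF//; lra.
have yb s : `|y s| <= 3 * (lam * (K + 1)).
  have a20 := sqr_ge0 a.
  have h1 : 0 <= lam * (1 - a ^+ 2) by rewrite mulr_ge0 ?(ltW lam0)//; lra.
  have h2 : lam * (1 - a ^+ 2) <= lam by rewrite ler_piMr ?(ltW lam0)//; lra.
  have h3 : lam * (1 - a ^+ 2) * f s <= lam * K by rewrite ler_pM.
  have h4 : 0 <= lam * (1 - a ^+ 2) * f s by rewrite mulr_ge0.
  have h5 : lam * k^-1 <= lam by rewrite ler_piMr ?(ltW lam0).
  have h6 : 0 <= lam * k^-1 by rewrite mulr_ge0 ?(ltW lam0) ?(ltW ki0).
  have h7 : lam ^+ 2 <= lam / 16 by rewrite expr2 ler_pM2l//; lra.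
  have h8 : lam ^+ 2 * K <= lam / 16 * K by rewrite ler_pM2r.
  have h9 : 0 <= lam ^+ 2 * K by rewrite mulr_ge0 ?(ltW K0)// exprn_ge0// ltW.
  have h10 : 0 <= lam ^+ 2 by rewrite sqr_ge0.
  by rewrite ler_norml /y; apply/andP; split; lra.
have ey s : expR (y s) <= 1 + y s + 18 * (lam * (K + 1)) ^+ 2.
  have : y s <= 1 / 2 by have := yb s; rewrite ler_norml => /andP[_]; lra.
  move=> /expR_le_quadratic/le_trans; apply; rewrite lerD2l.
  have : y s ^+ 2 <= (3 * (lam * (K + 1))) ^+ 2.
    rewrite -real_normK ?num_real// ler_sqr ?nnegrE//.
    by rewrite !mulr_ge0 ?ltW//; lra.
  by lra.
apply: (@le_trans _ _ (\sum_s P s * (1 + y s + 18 * (lam * (K + 1)) ^+ 2))).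
  by apply: ler_sum => s _; rewrite ler_wpM2l.
have -> : \sum_s P s * (1 + y s + 18 * (lam * (K + 1)) ^+ 2)
  = 1 - lam * (1 - a ^+ 2) * (\sum_s P s * f s - 1) + lam * k^-1
    + 8 * lam ^+ 2 * K + 16 * lam ^+ 2 + 18 * (lam * (K + 1)) ^+ 2.
  set z := lam * k^-1 + 8 * lam ^+ 2 * K + 16 * lam ^+ 2
     + 18 * (lam * (K + 1)) ^+ 2 + 1 + lam * (1 - a ^+ 2).
  transitivity (\sum_s (- (lam * (1 - a ^+ 2)) * (P s * f s) + z * P s)).
    by apply: eq_bigr => s _; rewrite /y /z; ring.
  by rewrite big_split/= -!mulr_sumr P1 /z; ring.
have g1 : lam * q0 * c <= lam * (1 - a ^+ 2) * (\sum_s P s * f s - 1).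
  rewrite -!mulrA ler_pM2l// ler_pM ?(ltW q00) ?(ltW c0)//.
  by move: Ef; rewrite -/f; lra.
have g2 : lam * k^-1 <= lam * (q0 * c / 4) by rewrite ler_pM2l.
have g3 : 34 * (lam * (K + 1)) ^+ 2 <= lam * (q0 * c / 4).
  have -> : lam * (q0 * c / 4) = 40 * (lam * (K + 1)) ^+ 2.
    by rewrite -lamE; field.
  by rewrite ler_wpM2r ?sqr_ge0//; lra.
have g4 : 8 * lam ^+ 2 * K + 16 * lam ^+ 2 <= 16 * (lam * (K + 1)) ^+ 2.
  have : 0 <= lam ^+ 2 * (24 * K + 16 * K ^+ 2).
    by rewrite mulr_ge0 ?sqr_ge0// addr_ge0 ?mulr_ge0 ?sqr_ge0 ?(ltW K0).
  by lra.
by lra.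
Qed.

End overlap.

(** * Integration of bounded functions against an i.i.d. law *)

Section bounded_measurable.
Context d (T : measurableType d) (R : realType).
Implicit Types F G : T -> R.

Definition bounded_measurable F :=
  measurable_fun setT F /\ exists B : R, forall x, `|F x| <= B.

Lemma bmeas_cst (c : R) : bounded_measurable (fun=> c).
Proof. by split; [exact: measurable_cst|exists `|c|]. Qed.

Lemma bmeasD F G : bounded_measurable F -> bounded_measurable G ->
  bounded_measurable (fun x => F x + G x).
Proof.
move=> [mF [a Fa]] [mG [b Gb]]; split; first exact: measurable_funD.
by exists (a + b) => x; rewrite (le_trans (ler_normD _ _))// lerD.
Qed.

Lemma bmeasM F G : bounded_measurable F -> bounded_measurable G ->
  bounded_measurable (fun x => F x * G x).
Proof.
move=> [mF [a Fa]] [mG [b Gb]]; split; first exact: measurable_funM.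
by exists (a * b) => x; rewrite normrM ler_pM.
Qed.

Lemma bmeas_sum (I : Type) (r : seq I) (Q : pred I) (F : I -> T -> R) :
  (forall i, bounded_measurable (F i)) ->
  bounded_measurable (fun x => \sum_(i <- r | Q i) F i x).
Proof.
move=> bF; elim: r => [|i r IH].
  by under eq_fun do rewrite big_nil; exact: bmeas_cst.
under eq_fun do rewrite big_cons.
by case: (Q i) => //; exact: bmeasD.
Qed.

Lemma bmeas_prod (I : Type) (r : seq I) (Q : pred I) (F : I -> T -> R) :
  (forall i, bounded_measurable (F i)) ->
  bounded_measurable (fun x => \prod_(i <- r | Q i) F i x).
Proof.
move=> bF; elim: r => [|i r IH].
  by under eq_fun do rewrite big_nil; exact: bmeas_cst.
under eq_fun do rewrite big_cons.
by case: (Q i) => //; exact: bmeasM.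
Qed.

Variable P : probability T R.

Lemma bmeas_integrable F : bounded_measurable F ->
  P.-integrable setT (EFin \o F).
Proof.
move=> [mF [a Fa]]; apply: measurable_bounded_integrable => //.
  by rewrite (le_lt_trans (probability_le1 _ _))// ltry.
by exists a; split; [exact: num_real|move=> b ab x _ /=; exact: le_trans (Fa x) (ltW ab)].
Qed.

Lemma Rintegral_sum (I : Type) (r : seq I) (F : I -> T -> R) :
  (forall i, bounded_measurable (F i)) ->
  \int[P]_x (\sum_(i <- r) F i x) = \sum_(i <- r) \int[P]_x F i x.
Proof.
move=> bF; elim: r => [|i r IH].
  rewrite big_nil; under eq_Rintegral do rewrite big_nil.
  by rewrite Rintegral_cst// mul0r.
rewrite big_cons -IH -RintegralD//; first last.
- by apply: bmeas_integrable; exact: bmeas_sum.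
- exact: bmeas_integrable.
- by under eq_Rintegral do rewrite big_cons.
Qed.

Lemma Rintegral_prob_cst (c : R) : \int[P]_x c = c.
Proof.
rewrite Rintegral_cst//= [X in fine X](_ : _ = 1%E) ?mulr1//.
exact: probability_setT.
Qed.

End bounded_measurable.

Lemma bmeas_comp d d' (T : measurableType d) (U : measurableType d')
    (R : realType) (F : U -> R) (g : T -> U) :
  bounded_measurable F -> measurable_fun setT g ->
  bounded_measurable (F \o g).
Proof.
move=> [mF [a Fa]] mg; split; first exact: measurableT_comp.
by exists a => x; exact: Fa.
Qed.

Section iid.
Context d (T : measurableType d) (R : realType) (mu : probability T R).

Definition box n (B : 'I_n -> set T) : set (n.-tuple T) :=
  [set t | forall i, B i (tnth t i)].

Lemma measurable_box n (B : 'I_n -> set T) : (forall i, measurable (B i)) ->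
  measurable (box B).
Proof.
move=> mB; have -> : box B = \bigcap_(i in [set: 'I_n]) ((tnth (T:=T))^~ i @^-1` B i).
  by apply/seteqP; split=> [t tB i _|t tB i]; [exact: tB|exact: tB].
apply: fin_bigcap_measurable => // i _; rewrite -[X in measurable X]setTI.
exact: measurable_tnth.
Qed.

Lemma iid_law_box n (B : 'I_n -> set T) : (forall i, measurable (B i)) ->
  (iid_law mu n (box B) = \prod_(i < n) mu (B i))%E.
Proof.
elim: n B => [|n IH] B mB.
  rewrite big_ord0/= diracE mem_set//.
  by move=> [].
rewrite big_ord_recl -IH// /= /distribution /pushforward.
have -> : @cons_pair _ T n @^-1` box B
    = B ord0 `*` box (fun i => B (lift ord0 i)).
  apply/seteqP; split => [[x t] /= H|[x t] /= [H0 H] i].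
    by split=> [|i]; [have := H ord0|have := H (lift ord0 i); rewrite tnthS].
  by case: (unliftP ord0 i) => [j ->|->] //=; rewrite tnthS; exact: H.
by rewrite product_measure1E//; exact: measurable_box.
Qed.

Definition boxes n : set (set (n.-tuple T)) :=
  [set A | exists2 B : 'I_n -> set T, forall i, measurable (B i) & A = box B].

Lemma measurable_tuple_boxes n :
  (measurable : set (set (n.-tuple T))) = <<s @boxes n >>.
Proof.
apply/seteqP; split.
  apply: smallest_sub; first exact: smallest_sigma_algebra.
  rewrite -bigcup_seq; apply: bigcup_sub => i _ A [Y mY <-].
  apply: sub_sigma_algebra; exists (fun j => if j == i then Y else setT).
    by move=> j; case: ifP.
  apply/seteqP; split=> [t [_ /= tY] j|t tY]; first by case: eqP => [->|].
  by split => //; have := tY i; rewrite eqxx.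
apply: smallest_sub; first exact: sigma_algebra_measurable.
by move=> A [B mB ->]; exact: measurable_box.
Qed.

Definition permute_tuple n (p : {perm 'I_n}) (t : n.-tuple T) : n.-tuple T :=
  [tuple tnth t (p i) | i < n].

Lemma measurable_permute n (p : {perm 'I_n}) :
  measurable_fun setT (@permute_tuple n p).
Proof.
apply/measurable_fun_tnthP => i.
rewrite (_ : _ \o _ = (tnth (T:=T))^~ (p i)); first exact: measurable_tnth.
by apply/funext => t /=; rewrite tnth_mktuple.
Qed.

HB.instance Definition _ n (p : {perm 'I_n}) :=
  isMeasurableFun.Build _ _ _ _ (@permute_tuple n p) (measurable_permute p).

(** Both measures give a box the product of the masses of its sides, and boxes
    form a pi-system that generates the product sigma-algebra. *)
Lemma iid_law_permute n (p : {perm 'I_n}) (A : set (n.-tuple T)) :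
  measurable A ->
  iid_law mu n A = distribution (iid_law mu n) (@permute_tuple n p) A.
Proof.
apply: (measure_unique (@boxes n) (fun=> setT)) => //.
- exact: measurable_tuple_boxes.
- move=> _ _ [B mB ->] [C mC ->]; exists (fun i => B i `&` C i).
    by move=> i; exact: measurableI.
  by apply/seteqP; split=> [t [tB tC] i|t tBC]; [split|split=> i; have [] := tBC i].
- by move=> _; exists (fun=> setT) => //; apply/seteqP; split.
- by rewrite bigcup_const.
- move=> _ [B mB ->].
  transitivity (\prod_(i < n) mu (B i))%E; first exact: iid_law_box.
  rewrite /= /distribution /pushforward.
  have -> : @permute_tuple n p @^-1` box B = box (fun i => B ((p^-1)%g i)).
    apply/seteqP; split=> [t tB i|t tB i] /=.
      by have := tB ((p^-1)%g i); rewrite tnth_mktuple permKV.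
    by rewrite tnth_mktuple; have := tB (p i); rewrite permK.
  rewrite iid_law_box//.
  by rewrite [LHS](reindex_inj (@perm_inj _ (p^-1)%g)).
- by move=> _; rewrite (le_lt_trans (probability_le1 _ _))// ltry.
Qed.

Lemma Rintegral_permute n (p : {perm 'I_n}) (F : n.-tuple T -> R) :
  bounded_measurable F ->
  \int[iid_law mu n]_h F (permute_tuple p h) = \int[iid_law mu n]_h F h.
Proof.
move=> bF; rewrite /Rintegral; congr fine.
rewrite [RHS](eq_measure_integral (distribution (iid_law mu n) (@permute_tuple n p))).
  rewrite integral_distribution//; first by apply/measurable_EFinP; case: bF.
  apply: (bmeas_integrable _ (F := F \o permute_tuple p)).
  by apply: bmeas_comp => //; exact: measurable_permute.
by move=> A mA _; exact: iid_law_permute.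
Qed.

End iid.

Section iid_factor.
Context d (T : measurableType d) (R : realType) (mu : probability T R).

(** Fubini's theorem for a function with separated variables. *)
Lemma Rintegral_prod_factor d' (U : measurableType d') (nu : probability U R)
    (u : T -> R) (G : U -> R) :
  bounded_measurable u -> bounded_measurable G ->
  fine (\int[mu \x nu]_z (u z.1 * G z.2)%:E)%E
  = (\int[mu]_x u x) * (\int[nu]_y G y).
Proof.
move=> bu bG.
have bz : bounded_measurable (fun z : T * U => u z.1 * G z.2).
  apply: bmeasM; first exact: bmeas_comp bu measurable_fst.
  exact: bmeas_comp bG measurable_snd.
have iz := bmeas_integrable (mu \x nu)%E bz.
rewrite -(integral12_prod_meas1 iz).
rewrite -(RintegralZr _ measurableT (bmeas_integrable mu bu))//.
congr fine; apply: eq_integral => x _; rewrite /fubini_F/=.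
rewrite -RintegralZl//; last exact: bmeas_integrable.
rewrite fineK//; apply: integrable_fin_num => //.
by apply: bmeas_integrable; apply: bmeasM => //; exact: bmeas_cst.
Qed.

Lemma Rintegral_iid_head n (u : T -> R) (F : n.+1.-tuple T -> R) :
  bounded_measurable u -> bounded_measurable F ->
  (forall x y t, F (cons_pair (x, t)) = F (cons_pair (y, t))) ->
  \int[iid_law mu n.+1]_h (F h * u (thead h))
  = (\int[iid_law mu n.+1]_h F h) * (\int[mu]_x u x).
Proof.
move=> bu bF F0.
(* [point] is a dummy value for the coordinate on which [F] does not depend. *)
pose G (t : n.-tuple T) := F (cons_pair (point, t)).
have mG : measurable_fun setT (fun t : n.-tuple T => cons_pair ((point : T), t)).
  apply: measurableT_comp; first exact: measurable_cons_pair.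
  exact: measurable_fun_pair.
have bG : bounded_measurable G by exact: bmeas_comp bF mG.
have E (v : T -> R) : bounded_measurable v ->
    \int[iid_law mu n.+1]_h (F h * v (thead h))
    = (\int[mu]_x v x) * \int[iid_law mu n]_t G t.
  move=> bv; rewrite -Rintegral_prod_factor// /Rintegral; congr fine.
  have mth : measurable_fun setT (fun h : n.+1.-tuple T => thead h).
    exact: measurable_tnth.
  have b1 : bounded_measurable (fun h : n.+1.-tuple T => F h * v (thead h)).
    by apply: bmeasM => //; exact: bmeas_comp bv mth.
  rewrite /= integral_distribution.
  - apply: eq_integral => -[x t] _ /=.
    by rewrite /G (F0 point x) theadE mulrC.
  - by apply/measurable_EFinP; case: b1.
  - apply: (bmeas_integrable _ (F := (fun h => F h * v (thead h)) \o @cons_pair _ T n)).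
    by apply: bmeas_comp => //; exact: measurable_cons_pair.
rewrite E// mulrC; congr (_ * _).
have := E (fun=> 1) (bmeas_cst _ _); rewrite Rintegral_prob_cst mul1r => <-.
by apply: eq_Rintegral => h _; rewrite mulr1.
Qed.

(** Independence of one coordinate from the others.  Exchangeability moves the
    coordinate [i] to the head, where the law is by definition a binary
    product. *)
Lemma Rintegral_iid_factor n (i : 'I_n) (u : T -> R) (F : n.-tuple T -> R) :
  bounded_measurable u -> bounded_measurable F ->
  (forall h h' : n.-tuple T,
     (forall j, j != i -> tnth h j = tnth h' j) -> F h = F h') ->
  \int[iid_law mu n]_h (F h * u (tnth h i))
  = (\int[iid_law mu n]_h F h) * (\int[mu]_x u x).
Proof.
case: n i F => [[]//|n] i F bu bF Fi.
pose p := tperm ord0 i.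
have bFu : bounded_measurable (fun h => F h * u (tnth h i)).
  by apply: bmeasM => //; apply: bmeas_comp bu (measurable_tnth i).
rewrite -(Rintegral_permute mu p bFu) -(Rintegral_permute mu p bF).
have bFp : bounded_measurable (F \o permute_tuple p).
  by apply: bmeas_comp => //; exact: measurable_permute.
rewrite -(@Rintegral_iid_head n u (F \o permute_tuple p))//.
  by apply: eq_Rintegral => h _; rewrite tnth_mktuple tpermR.
move=> x y t /=; apply: Fi => j ji; rewrite !tnth_mktuple.
have : p j != ord0 by rewrite -(tpermR ord0 i) (inj_eq perm_inj).
case: (unliftP ord0 (p j)) => [l ->|->]; last by rewrite eqxx.
by rewrite !tnthS.
Qed.

End iid_factor.

(** * Association and truncated means under an exponential tilt *)

Section association.
Context {R : realType}.
Variables (I : finType) (p : I -> R).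
Hypothesis p0 : forall s, 0 <= p s.
Implicit Types f g u w Y : I -> R.

(** Symmetrizing the double sum in [s] and [s'] turns the difference of the two
    sides into half the sum of the nonnegative quantities of the hypothesis. *)
Lemma chebyshev_association w u f :
  (forall s s', 0 <= (w s * u s' - w s' * u s) * (f s - f s')) ->
  (\sum_s p s * u s * f s) * (\sum_s p s * w s)
  <= (\sum_s p s * w s * f s) * (\sum_s p s * u s).
Proof.
move=> H; rewrite -subr_ge0.
set X := (X in 0 <= X).
have XE : X = \sum_s \sum_s' p s * p s' * (w s * u s' * (f s - f s')).
  rewrite /X (mulrC (\sum_s p s * u s * f s)) !big_distrlr/= -sumrB.
  by apply: eq_bigr => s _; rewrite -sumrB; apply: eq_bigr => s' _; ring.
have XX : X + X = \sum_s \sum_s' p s * p s' *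
    ((w s * u s' - w s' * u s) * (f s - f s')).
  rewrite {2}XE exchange_big/= XE -big_split/=; apply: eq_bigr => s _.
  by rewrite -big_split/=; apply: eq_bigr => s' _; ring.
suff : 0 <= X + X by lra.
rewrite XX; apply: sumr_ge0 => s _; apply: sumr_ge0 => s' _.
by rewrite mulr_ge0// mulr_ge0.
Qed.

Hypothesis p1 : \sum_s p s = 1.

Lemma sqr_mean_le f : (\sum_s p s * f s) ^+ 2 <= \sum_s p s * f s ^+ 2.
Proof.
set m := \sum_s p s * f s; rewrite -subr_ge0.
have -> : \sum_s p s * f s ^+ 2 - m ^+ 2 = \sum_s p s * (f s - m) ^+ 2.
  transitivity (\sum_s (p s * f s ^+ 2 + (- (2 * m)) * (p s * f s) + m ^+ 2 * p s)).
    by rewrite !big_split/= -!mulr_sumr p1 -/m; ring.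
  by apply: eq_bigr => s _; ring.
by apply: sumr_ge0 => s _; rewrite mulr_ge0 ?sqr_ge0.
Qed.

(** From [Var f <= 2 Var g + 2 Var (f - g)], which is
    [0 <= Var (2 g - f)]. *)
Lemma variance_subr_ge f g :
  (\sum_s p s * f s ^+ 2 - (\sum_s p s * f s) ^+ 2) / 2 - \sum_s p s * (f s - g s) ^+ 2
  <= \sum_s p s * g s ^+ 2 - (\sum_s p s * g s) ^+ 2.
Proof.
have := sqr_mean_le (fun s => 2 * g s - f s).
have -> : \sum_s p s * (2 * g s - f s) = 2 * (\sum_s p s * g s) - \sum_s p s * f s.
  by rewrite mulr_sumr -sumrB; apply: eq_bigr => s _; ring.
have := sqr_ge0 (\sum_s p s * f s - \sum_s p s * g s).
have -> : \sum_s p s * (f s - g s) ^+ 2 =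
    \sum_s p s * f s ^+ 2 - 2 * (\sum_s p s * (f s * g s)) + \sum_s p s * g s ^+ 2.
  by rewrite mulr_sumr -sumrB -big_split/=; apply: eq_bigr => s _; ring.
have -> : \sum_s p s * (2 * g s - f s) ^+ 2 = 4 * (\sum_s p s * g s ^+ 2)
    - 4 * (\sum_s p s * (f s * g s)) + \sum_s p s * f s ^+ 2.
  by rewrite !mulr_sumr -sumrB -big_split/=; apply: eq_bigr => s _; ring.
by lra.
Qed.

Variables (Y : I -> R) (K theta : R).
Hypotheses (Y0 : forall s, 0 <= Y s) (K0 : 0 < K) (theta0 : 0 < theta).
Let f s := Num.min (Y s) K.

Let f0 s : 0 <= f s. Proof. by rewrite /f le_min Y0 ltW. Qed.
Let fY s : f s <= Y s. Proof. by rewrite /f ge_min lexx. Qed.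
Let fK s : f s <= K. Proof. by rewrite /f ge_min lexx orbT. Qed.

(** Since [Y - f] vanishes unless [Y > K], it is at most [Y^3 / K^2]. *)
Lemma trunc_mean_ge :
  \sum_s p s * Y s - (\sum_s p s * Y s ^+ 3) / K ^+ 2 <= \sum_s p s * f s.
Proof.
rewrite mulr_suml -sumrB; apply: ler_sum => s _.
rewrite -mulrA -mulrBr ler_wpM2l// /f; have [YK|KY] := leP (Y s) K.
  by rewrite gerBl// divr_ge0 ?exprn_ge0 ?(ltW K0).
rewrite lerBlDr -lerBlDl ler_pdivlMr ?exprn_gt0//.
have h1 : K ^+ 2 <= Y s ^+ 2 by rewrite ler_sqr ?nnegrE ?(ltW K0)// ltW.
have h2 : (Y s - K) * K ^+ 2 <= Y s * K ^+ 2.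
  by rewrite ler_wpM2r ?sqr_ge0// gerBl ltW.
by apply: (le_trans h2); rewrite [Y s ^+ 3]exprS ler_wpM2l.
Qed.

(** Since [Y - f] vanishes unless [Y > K], its square is at most [Y^3 / K]. *)
Lemma trunc_variance_ge :
  (\sum_s p s * Y s ^+ 2 - (\sum_s p s * Y s) ^+ 2) / 2 - (\sum_s p s * Y s ^+ 3) / K
  <= \sum_s p s * f s ^+ 2 - (\sum_s p s * f s) ^+ 2.
Proof.
apply: le_trans (variance_subr_ge Y f); rewrite lerD2l lerN2 mulr_suml.
apply: ler_sum => s _; rewrite -mulrA ler_wpM2l// ler_pdivlMr// /f.
have [YK|KY] := leP (Y s) K.
  by rewrite subrr expr0n/= mul0r exprn_ge0.
have h1 : (Y s - K) ^+ 2 <= Y s ^+ 2.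
  by rewrite ler_sqr ?nnegrE ?subr_ge0 ?gerBl ?(ltW K0)// ltW.
apply: (@le_trans _ _ (Y s ^+ 2 * K)); first by rewrite ler_wpM2r// ltW.
by rewrite [Y s ^+ 3]exprSr ler_wpM2l ?sqr_ge0// ltW.
Qed.

Let w s := expR (theta / 2 * Y s).
Let eps := theta / 2.

(** The weight [w = exp (theta Y / 2)] is compared with [1 + eps f], whose tilted
    mean of [f] is [a + eps (b - a^2) / (1 + eps a)] for [a] and [b] the first two
    moments of [f].  The ratio of [w] to [1 + eps f] is
    nondecreasing in [Y] because [f] is 1-Lipschitz in [Y] and
    [1 + x <= exp x]. *)
Lemma tilted_trunc_mean_ge :
  \sum_s p s * f s
  + eps / (1 + eps * K) * (\sum_s p s * f s ^+ 2 - (\sum_s p s * f s) ^+ 2)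
  <= (\sum_s p s * w s * f s) / (\sum_s p s * w s).
Proof.
have e0 : 0 < eps by rewrite /eps divr_gt0.
have wp0 : 0 < \sum_s p s * w s.
  rewrite lt_neqAle sumr_ge0 ?andbT; last by move=> s _; rewrite mulr_ge0 ?expR_ge0.
  apply/eqP => H.
  have /eqP := oner_neq0 R; rewrite -{}p1; apply.
  apply: big1 => s _.
  have /psumr_eq0P : \sum_s p s * w s = 0 by rewrite -H.
  move=> /(_ _)/(_ s) h; have : p s * w s = 0.
    by apply: h => // i _; rewrite mulr_ge0 ?expR_ge0.
  by move=> /eqP; rewrite mulf_eq0 (gt_eqF (expR_gt0 _)) orbF => /eqP.
have assoc := @chebyshev_association w (fun s => 1 + eps * f s) f.
set a := \sum_s p s * f s; set b := \sum_s p s * f s ^+ 2.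
have E1 : \sum_s p s * (1 + eps * f s) * f s = a + eps * b.
  by rewrite mulr_sumr -big_split/=; apply: eq_bigr => s _; ring.
have E2 : \sum_s p s * (1 + eps * f s) = 1 + eps * a.
  by rewrite -[X in X + _]p1 mulr_sumr -big_split/=; apply: eq_bigr => s _; ring.
have a0 : 0 <= a by apply: sumr_ge0 => s _; rewrite mulr_ge0.
have aK : a <= K.
  by rewrite -[K]mul1r -p1 mulr_suml; apply: ler_sum => s _; rewrite ler_wpM2l.
have ab : a ^+ 2 <= b by exact: sqr_mean_le.
have ea0 : 0 <= eps * a by rewrite mulr_ge0 ?(ltW e0).
have eaK : eps * a <= eps * K by rewrite ler_pM2l.
have d1 : 0 < 1 + eps * a by lra.
have d2 : 0 < 1 + eps * K by lra.
apply: (@le_trans _ _ ((a + eps * b) / (1 + eps * a))).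
  have -> : (a + eps * b) / (1 + eps * a) = a + eps / (1 + eps * a) * (b - a ^+ 2).
    by field; rewrite gt_eqF.
  rewrite lerD2l; apply: ler_wpM2r; first by rewrite subr_ge0.
  by apply: ler_wpM2l; [exact: ltW|rewrite lef_pV2 ?posrE// lerD2l].
rewrite ler_pdivlMr// mulrAC ler_pdivrMr// -E1 -E2; apply: assoc => s s'.
have key x y : f y < f x -> 0 <= w x * (1 + eps * f y) - w y * (1 + eps * f x).
  move=> fxy.
  have Yxy : f x - f y <= Y x - Y y.
    move: fxy; rewrite /f; have [h1|h1] := leP (Y x) K; have [h2|h2] := leP (Y y) K; lra.
  have -> : w x = w y * expR (eps * (Y x - Y y)).
    by rewrite /w /eps -expRD; congr expR; ring.
  rewrite -mulrA -mulrBr mulr_ge0 ?expR_ge0// subr_ge0.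
  have h3 : 1 + eps * (f x - f y) <= expR (eps * (Y x - Y y)).
    by apply: le_trans (expR_ge1Dx _); rewrite lerD2l ler_pM2l.
  have h4 : 0 < 1 + eps * f y by rewrite ltr_pwDl// mulr_ge0// ltW.
  apply: le_trans (ler_wpM2r (ltW h4) h3).
  have : 0 <= eps * (f x - f y) * (eps * f y).
    apply: mulr_ge0; last by rewrite mulr_ge0 ?(ltW e0).
    by apply: mulr_ge0; [exact: ltW|rewrite subr_ge0 ltW].
  by lra.
have [fs|fs|->] := ltgtP (f s) (f s'); last by rewrite subrr mulr0.
- have := key _ _ fs; rewrite -oppr_le0 opprB => h.
  by rewrite mulr_le0// subr_le0 ltW.
- by rewrite mulr_ge0 ?key// subr_ge0 ltW.
Qed.

(** In terms of moments of [Y] the bound can be averaged over a random [p]. *)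
Lemma tilted_trunc_mean_moments (m1 m2 m3 : R) :
  m1 = \sum_s p s * Y s -> m2 = \sum_s p s * Y s ^+ 2 ->
  m3 = \sum_s p s * Y s ^+ 3 ->
  m1 - m3 / K ^+ 2 + eps / (1 + eps * K) * ((m2 - m1 ^+ 2) / 2 - m3 / K)
  <= (\sum_s p s * w s * f s) / (\sum_s p s * w s).
Proof.
move=> -> -> ->; apply: le_trans tilted_trunc_mean_ge.
apply: lerD; first exact: trunc_mean_ge.
apply: ler_wpM2l; last exact: trunc_variance_ge.
by rewrite divr_ge0// ?addr_ge0// ?mulr_ge0// ?/eps ?divr_ge0 ?(ltW theta0) ?(ltW K0).
Qed.

End association.

(** * Product laws on spin configurations *)

Lemma set_ind_card (T : finType) (Q : {set T} -> Prop) :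
  Q finset.set0 ->
  (forall i (A : {set T}), i \notin A -> Q A -> Q (i |: A)) -> forall A, Q A.
Proof.
move=> Q0 QS A; elim: {A}#|A| {-2}A (erefl #|A|) => [|l IH] A Al.
  by have -> : A = finset.set0 by apply/eqP; rewrite -cards_eq0 Al.
have [i iA] : exists i, i \in A by apply/set0Pn; rewrite -cards_eq0 Al.
rewrite -(finset.setD1K iA); apply: QS; first by rewrite !inE eqxx.
by apply: IH; move: Al; rewrite (cardsD1 i) iA => -[].
Qed.

Section product_spins.
Context {R : realType}.
Variable n : nat.
Implicit Types (t : 'I_n -> R) (s : config n) (G : config n -> R) (A : {set 'I_n}).

(** The product law on spins with mean [t i] at site [i]. *)
Definition pspin t s : R := \prod_(i < n) ((1 + t i * spin (s i)) / 2).

Lemma pspin_ge0 t s : (forall i, `|t i| <= 1) -> 0 <= pspin t s.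
Proof.
move=> t1; apply: prodr_ge0 => i _; have := t1 i; rewrite ler_norml => /andP[h1 h2].
by rewrite divr_ge0//; case: (s i); rewrite /spin; lra.
Qed.

Lemma sum_pspin t : \sum_s pspin t s = 1.
Proof.
rewrite /pspin -(bigA_distr_bigA (fun i b => (1 + t i * spin b) / 2))/=.
by apply: big1 => i _; rewrite big_bool/=; field.
Qed.

Definition pspin_off i t s : R :=
  \prod_(j < n | j != i) ((1 + t j * spin (s j)) / 2).

Lemma pspinE i t s : pspin t s = (1 + t i * spin (s i)) / 2 * pspin_off i t s.
Proof. by rewrite /pspin (bigD1 i). Qed.

Lemma pspin_off_flip i t s : pspin_off i t (flip i s) = pspin_off i t s.
Proof. by apply: eq_bigr => j ji; rewrite ffunE (negbTE ji). Qed.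

(** Summing over the spin at [i] removes [t i] from the mean of a function that
    does not depend on that spin. *)
Lemma mean_off i t G : flip_invariant i G ->
  \sum_s pspin t s * G s = (\sum_s pspin_off i t s * G s) / 2.
Proof.
move=> fG; set X := LHS; suff : X + X = \sum_s pspin_off i t s * G s by lra.
rewrite /X -{2}(sum_flip i) -big_split/=; apply: eq_bigr => s _.
by rewrite !(pspinE i) pspin_off_flip fG ffunE eqxx spin_negb; field.
Qed.

Lemma mean_spin i t G : flip_invariant i G ->
  \sum_s pspin t s * (G s * spin (s i)) = t i * \sum_s pspin t s * G s.
Proof.
move=> fG; rewrite (mean_off t fG); set X := LHS.
suff : X + X = t i * (\sum_s pspin_off i t s * G s) by lra.
rewrite /X -{2}(sum_flip i) -big_split/= mulr_sumr; apply: eq_bigr => s _.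
rewrite !(pspinE i) pspin_off_flip fG ffunE eqxx spin_negb.
by case: (s i); rewrite /spin; field.
Qed.

Lemma magnU1 A i s : i \notin A -> magn (i |: A) s = spin (s i) + magn A s :> R.
Proof. by move=> iA; rewrite /magn big_setU1. Qed.

Definition drift t A : R := \sum_(i in A) t i.

(** Twice the second elementary symmetric function of the [t i], [i \in A]. *)
Definition pair_drift t A : R := drift t A ^+ 2 - \sum_(i in A) t i ^+ 2.

Lemma mean_magn t A : \sum_s pspin t s * magn A s = drift t A.
Proof.
elim/set_ind_card: A => [|i A iA IH].
  by rewrite /drift big_set0; apply: big1 => s _; rewrite /magn big_set0 mulr0.
rewrite /drift big_setU1//= -/(drift t A) -IH.
have := @mean_spin i t (fun=> 1) (fun=> erefl).
under [X in _ = _ * X]eq_bigr do rewrite mulr1.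
rewrite sum_pspin mulr1 => <-; rewrite -big_split/=; apply: eq_bigr => s _.
by rewrite magnU1//; ring.
Qed.

Lemma flip_invariant_magn i A k : i \notin A ->
  flip_invariant i (fun s => magn A s ^+ k : R).
Proof. by move=> iA s; rewrite magn_flip. Qed.

Lemma mean_magn2 t A :
  \sum_s pspin t s * magn A s ^+ 2 = #|A|%:R + pair_drift t A.
Proof.
elim/set_ind_card: A => [|i A iA IH].
  rewrite /pair_drift /drift !big_set0 cards0 expr0n/= subrr addr0.
  by apply: big1 => s _; rewrite /magn big_set0 expr0n/= mulr0.
have fm : flip_invariant i (@magn R n A) by move=> s; rewrite magn_flip.
have H1 := mean_spin t fm; rewrite mean_magn in H1.
transitivity (\sum_s (pspin t s * magn A s ^+ 2
    + 2 * (pspin t s * (magn A s * spin (s i))) + pspin t s)).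
  by apply: eq_bigr => s _; rewrite magnU1// sqrrD sqr_spin; ring.
rewrite !big_split/= -mulr_sumr H1 IH sum_pspin cardsU1 iA add1n -natr1.
by rewrite /pair_drift /drift !big_setU1//=; ring.
Qed.

Let t0 : 'I_n -> R := fun=> 0.

Lemma mean_unif_odd i G : flip_invariant i G ->
  \sum_s pspin t0 s * (G s * spin (s i)) = 0.
Proof. by move=> fG; rewrite mean_spin// /t0 mul0r. Qed.

Lemma mean_unif_magn2 A : \sum_s pspin t0 s * magn A s ^+ 2 = #|A|%:R.
Proof.
by rewrite mean_magn2 /pair_drift /drift /t0 !big1 ?expr0n ?subr0 ?addr0.
Qed.

Lemma mean_unif_magn4 A :
  \sum_s pspin t0 s * magn A s ^+ 4 = 3 * #|A|%:R ^+ 2 - 2 * #|A|%:R.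
Proof.
elim/set_ind_card: A => [|i A iA IH].
  rewrite cards0 expr0n/= !mulr0 subrr.
  by apply: big1 => s _; rewrite /magn big_set0 expr0n/= mulr0.
have H3 := mean_unif_odd (@flip_invariant_magn i A 3 iA).
have H1 := mean_unif_odd (@flip_invariant_magn i A 1 iA).
transitivity (\sum_s (pspin t0 s * magn A s ^+ 4 + 6 * (pspin t0 s * magn A s ^+ 2)
   + 4 * (pspin t0 s * (magn A s ^+ 3 * spin (s i)))
   + 4 * (pspin t0 s * (magn A s ^+ 1 * spin (s i))) + pspin t0 s)).
  apply: eq_bigr => s _; rewrite magnU1//.
  by case: (s i); rewrite /spin/=; ring.
rewrite !big_split/= -!mulr_sumr H1 H3 IH mean_unif_magn2 sum_pspin.
by rewrite cardsU1 iA add1n -natr1; ring.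
Qed.

Lemma mean_unif_magn6 A :
  \sum_s pspin t0 s * magn A s ^+ 6 <= 15 * #|A|%:R ^+ 3.
Proof.
elim/set_ind_card: A => [|i A iA IH].
  rewrite cards0 expr0n/= mulr0 big1// => s _.
  by rewrite /magn big_set0 expr0n/= mulr0.
have H5 := mean_unif_odd (@flip_invariant_magn i A 5 iA).
have H3 := mean_unif_odd (@flip_invariant_magn i A 3 iA).
have H1 := mean_unif_odd (@flip_invariant_magn i A 1 iA).
have -> : \sum_s pspin t0 s * magn (i |: A) s ^+ 6 =
  \sum_s (pspin t0 s * magn A s ^+ 6 + 15 * (pspin t0 s * magn A s ^+ 4)
   + 15 * (pspin t0 s * magn A s ^+ 2)
   + 6 * (pspin t0 s * (magn A s ^+ 5 * spin (s i)))
   + 20 * (pspin t0 s * (magn A s ^+ 3 * spin (s i)))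
   + 6 * (pspin t0 s * (magn A s ^+ 1 * spin (s i))) + pspin t0 s).
  apply: eq_bigr => s _; rewrite magnU1//.
  by case: (s i); rewrite /spin; ring.
rewrite !big_split/= -!mulr_sumr H1 H3 H5 mean_unif_magn4 mean_unif_magn2 sum_pspin.
rewrite cardsU1 iA add1n -natr1; move: IH; set k : R := #|A|%:R.
have k0 : 0 <= k by [].
by lra.
Qed.

End product_spins.

(** * Moments over the random field *)

Section hyperbolic.
Context {R : realType}.

Lemma measurable_inv_pos d (T : measurableType d) (F : T -> R) :
  measurable_fun setT F -> (forall x, 0 < F x) ->
  measurable_fun setT (fun x => (F x)^-1).
Proof.
move=> mF F0; rewrite (_ : (fun x => _) = (fun x => expR (- ln (F x)))).
  apply: measurableT_comp; first exact: measurable_expR.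
  by apply: measurable_funN; apply: measurableT_comp => //; exact: measurable_ln.
by apply/funext => x; rewrite expRN lnK// posrE.
Qed.

Lemma bmeas_inv d (T : measurableType d) (F : T -> R) :
  bounded_measurable F -> (forall x, 1 <= F x) ->
  bounded_measurable (fun x => (F x)^-1).
Proof.
move=> [mF _] F1; have F0 x : 0 < F x by rewrite (lt_le_trans ltr01).
split; first exact: measurable_inv_pos.
by exists 1 => x; rewrite ger0_norm ?invr_ge0 ?(ltW (F0 x))// invf_le1.
Qed.

Let cosh_gt0 (x : R) : 0 < expR x + expR (- x).
Proof. by rewrite addr_gt0 ?expR_gt0. Qed.

Lemma tanh_bound (x : R) : `|tanh x| <= 1.
Proof.
rewrite /tanh normrM normfV (gtr0_norm (cosh_gt0 x)) ler_pdivrMr// mul1r ler_norml.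
by have := expR_gt0 x; have := expR_gt0 (- x) => h1 h2; apply/andP; split; lra.
Qed.

Lemma sqr_sech (x : R) : sech x ^+ 2 = 1 - tanh x ^+ 2.
Proof.
rewrite /sech /tanh !exprMn exprVn.
have e : expR x * expR (- x) = 1 by rewrite -expRD subrr expR0.
apply: (@mulIf _ ((expR x + expR (- x)) ^+ 2)).
  by rewrite expf_neq0// gt_eqF.
rewrite mulrBl !mulfVK ?expf_neq0 ?gt_eqF//.
move: e; set a := expR x; set b := expR (- x) => e.
rewrite mul1r; have -> : (a + b) ^+ 2 - (a - b) ^+ 2 = 4 * (a * b) by ring.
by rewrite e; ring.
Qed.

Lemma expR_spin_tanh (x : R) b :
  expR (x * spin b) = (expR x + expR (- x)) * ((1 + tanh x * spin b) / 2).
Proof.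
have c0 := cosh_gt0 x.
rewrite /tanh; case: b; rewrite /spin ?mulr1 ?mulrN1; field; exact: lt0r_neq0.
Qed.

Lemma bmeas_tanh : @bounded_measurable _ (measurableTypeR R) R (@tanh R).
Proof.
split; last by exists 1; exact: tanh_bound.
apply: measurable_funM.
  apply: measurable_funB; first exact: measurable_expR.
  by apply: measurableT_comp; [exact: measurable_expR|exact: measurable_funN].
apply: measurable_inv_pos => //.
apply: measurable_funD; first exact: measurable_expR.
by apply: measurableT_comp; [exact: measurable_expR|exact: measurable_funN].
Qed.

End hyperbolic.

Section field.
Context {R : realType}.
Variable mu : probability (measurableTypeR R) R.
Variable n : nat.
Implicit Types (h : n.-tuple R) (s : config n) (A S : {set 'I_n}).

Definition tanh_field h (i : 'I_n) : R := tanh (tnth h i).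

Let T := measurableTypeR R.

Lemma bmeas_coord (u : T -> R) (i : 'I_n) : bounded_measurable u ->
  @bounded_measurable _ (n.-tuple T) R (fun h => u (tnth h i)).
Proof. by move=> bu; apply: bmeas_comp bu (measurable_tnth i). Qed.

Lemma bmeas_tanh_field i :
  @bounded_measurable _ (n.-tuple T) R (fun h => tanh_field h i).
Proof. exact: bmeas_coord bmeas_tanh. Qed.

Lemma bmeasX d (U : measurableType d) (F : U -> R) k : bounded_measurable F ->
  bounded_measurable (fun x => F x ^+ k).
Proof.
move=> bF; elim: k => [|k IH]; first exact: bmeas_cst.
by under eq_fun do rewrite exprS; exact: bmeasM.
Qed.

Lemma Rintegral_iid_prod (u : 'I_n -> T -> R) A :
  (forall i, bounded_measurable (u i)) ->
  \int[iid_law mu n]_h (\prod_(i in A) u i (tnth h i))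
  = \prod_(i in A) \int[mu]_x u i x.
Proof.
move=> bu; elim/set_ind_card: A => [|i A iA IH].
  rewrite big_set0; under eq_Rintegral do rewrite big_set0.
  exact: Rintegral_prob_cst.
rewrite big_setU1//= -IH mulrC -(Rintegral_iid_factor mu (i := i))//.
- by apply: eq_Rintegral => h _; rewrite big_setU1//= mulrC.
- by apply: bmeas_prod => j; exact: bmeas_coord.
- move=> h h' hh; apply: eq_bigr => j jA; rewrite hh//.
  by apply/eqP => ji; rewrite -ji jA in iA.
Qed.

Hypothesis htanh : \int[mu]_x tanh x = 0.

Lemma Rintegral_pspin s :
  \int[iid_law mu n]_h pspin (tanh_field h) s = pspin (fun=> 0) s.
Proof.
have E h : pspin (tanh_field h) s =
    \prod_(i in [set: 'I_n]%SET) ((1 + tanh (tnth h i) * spin (s i)) / 2).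
  by apply: eq_bigl => i; rewrite inE.
under eq_Rintegral do rewrite E.
have bu i : @bounded_measurable _ T R (fun x => (1 + tanh x * spin (s i)) / 2).
  apply: bmeasM; last exact: bmeas_cst.
  apply: bmeasD; first exact: bmeas_cst.
  by apply: bmeasM; [exact: bmeas_tanh|exact: bmeas_cst].
rewrite (Rintegral_iid_prod (u := fun i x => (1 + tanh x * spin (s i)) / 2))//.
rewrite /pspin; apply: eq_big => [i|i _]; first by rewrite inE.
have bt : @bounded_measurable _ T R (fun x => tanh x * spin (s i)).
  by apply: bmeasM; [exact: bmeas_tanh|exact: bmeas_cst].
rewrite RintegralZr//; last first.
  by apply: bmeas_integrable; apply: bmeasD => //; exact: bmeas_cst.
rewrite RintegralD//; [|exact: bmeas_integrable (bmeas_cst _ _)|exact: bmeas_integrable].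
rewrite Rintegral_prob_cst RintegralZr//; last exact: bmeas_integrable bmeas_tanh.
by rewrite htanh.
Qed.

Lemma bmeas_pspin s :
  @bounded_measurable _ (n.-tuple T) R (fun h => pspin (tanh_field h) s).
Proof.
apply: bmeas_prod => i; apply: bmeasM; last exact: bmeas_cst.
apply: bmeasD; first exact: bmeas_cst.
by apply: bmeasM; [exact: bmeas_tanh_field|exact: bmeas_cst].
Qed.

(** Averaging the product law with means [tanh h_i] over the field gives the
    uniform law, since [pspin] is affine in each mean and [E tanh h = 0]. *)
Lemma Rintegral_mean (G : config n -> R) :
  \int[iid_law mu n]_h (\sum_s pspin (tanh_field h) s * G s)
  = \sum_s pspin (fun=> 0) s * G s.
Proof.
rewrite Rintegral_sum; last first.
  by move=> s; apply: bmeasM; [exact: bmeas_pspin|exact: bmeas_cst].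
apply: eq_bigr => s _; rewrite RintegralZr//; last first.
  exact: bmeas_integrable (bmeas_pspin s).
by rewrite Rintegral_pspin.
Qed.

Let tau := \int[mu]_x (tanh x ^+ 2).

Let D A h := drift (tanh_field h) A.
Let Q A h := pair_drift (tanh_field h) A.

Lemma bmeas_drift A : @bounded_measurable _ (n.-tuple T) R (D A).
Proof. by apply: bmeas_sum => i; exact: bmeas_tanh_field. Qed.

Lemma bmeas_pair_drift A : @bounded_measurable _ (n.-tuple T) R (Q A).
Proof.
have -> : Q A = (fun h => D A h ^+ 2 + (-1) * \sum_(i in A) tanh_field h i ^+ 2).
  by apply/funext => h; rewrite /Q /pair_drift mulN1r.
apply: bmeasD; first by apply: bmeasX; exact: bmeas_drift.
apply: bmeasM; first exact: bmeas_cst.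
by apply: bmeas_sum => i; apply: bmeasX; exact: bmeas_tanh_field.
Qed.

Let drift_indep A i : i \notin A -> forall h h' : n.-tuple T,
  (forall j, j != i -> tnth h j = tnth h' j) ->
  D A h = D A h' /\ Q A h = Q A h'.
Proof.
move=> iA h h' hh.
have e j : j \in A -> tanh_field h j = tanh_field h' j.
  move=> jA; rewrite /tanh_field hh//.
  by apply/eqP => ji; rewrite -ji jA in iA.
have DD : D A h = D A h' by apply: eq_bigr => j jA; rewrite e.
split=> //; rewrite /Q /pair_drift -/(D A h) -/(D A h') DD; congr (_ - _).
by apply: eq_bigr => j jA; rewrite e.
Qed.

Let int_odd i (F : n.-tuple T -> R) : bounded_measurable F ->
  (forall h h' : n.-tuple T,
     (forall j, j != i -> tnth h j = tnth h' j) -> F h = F h') ->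
  \int[iid_law mu n]_h (F h * tanh_field h i) = 0.
Proof.
move=> bF Fi; rewrite (Rintegral_iid_factor mu (u := @tanh R))//.
  by rewrite htanh mulr0.
exact: bmeas_tanh.
Qed.

Let int_even i (F : n.-tuple T -> R) : bounded_measurable F ->
  (forall h h' : n.-tuple T,
     (forall j, j != i -> tnth h j = tnth h' j) -> F h = F h') ->
  \int[iid_law mu n]_h (F h * tanh_field h i ^+ 2) = (\int[iid_law mu n]_h F h) * tau.
Proof.
move=> bF Fi; rewrite (Rintegral_iid_factor mu (u := fun x => tanh x ^+ 2))//.
by apply: bmeasX; exact: bmeas_tanh.
Qed.

Lemma Rintegral_pair_drift A : \int[iid_law mu n]_h Q A h = 0.
Proof.
elim/set_ind_card: A => [|i A iA IH].
  rewrite -[RHS](Rintegral_prob_cst (iid_law mu n)); apply: eq_Rintegral => h _.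
  by rewrite /Q /pair_drift /drift !big_set0 expr0n subrr.
have E h : Q (i |: A) h = Q A h + 2 * (D A h * tanh_field h i).
  by rewrite /Q /D /pair_drift /drift !big_setU1//=; ring.
under eq_Rintegral do rewrite E.
have bD : @bounded_measurable _ (n.-tuple T) R (fun h => D A h * tanh_field h i).
  by apply: bmeasM; [exact: bmeas_drift|exact: bmeas_tanh_field].
rewrite RintegralD//; [|exact: bmeas_integrable (bmeas_pair_drift A)|].
  rewrite IH RintegralZl//; last exact: bmeas_integrable.
  by rewrite int_odd ?mulr0 ?addr0//; [exact: bmeas_drift|move=> h h' /(drift_indep iA)[]].
by apply: bmeas_integrable; apply: bmeasM => //; exact: bmeas_cst.
Qed.

Lemma Rintegral_drift2 A : \int[iid_law mu n]_h (D A h ^+ 2) = #|A|%:R * tau.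
Proof.
elim/set_ind_card: A => [|i A iA IH].
  rewrite cards0 mul0r -[RHS](Rintegral_prob_cst (iid_law mu n)).
  by apply: eq_Rintegral => h _; rewrite /D /drift !big_set0 expr0n.
have E h : D (i |: A) h ^+ 2 = D A h ^+ 2 + 2 * (D A h * tanh_field h i)
    + 1 * tanh_field h i ^+ 2.
  by rewrite /D /drift !big_setU1//=; ring.
under eq_Rintegral do rewrite E.
have bD : @bounded_measurable _ (n.-tuple T) R (fun h => D A h * tanh_field h i).
  by apply: bmeasM; [exact: bmeas_drift|exact: bmeas_tanh_field].
have b1 : @bounded_measurable _ (n.-tuple T) R (fun h => D A h ^+ 2).
  by apply: bmeasX; exact: bmeas_drift.
have b2 : @bounded_measurable _ (n.-tuple T) R (fun h => 2 * (D A h * tanh_field h i)).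
  by apply: bmeasM => //; exact: bmeas_cst.
have b3 : @bounded_measurable _ (n.-tuple T) R (fun h => 1 * tanh_field h i ^+ 2).
  by apply: bmeasM; [exact: bmeas_cst|apply: bmeasX; exact: bmeas_tanh_field].
rewrite RintegralD//; [|exact: bmeas_integrable (bmeasD b1 b2)|exact: bmeas_integrable].
rewrite RintegralD//; [|exact: bmeas_integrable|exact: bmeas_integrable].
rewrite IH RintegralZl//; last exact: bmeas_integrable.
rewrite int_odd//; [|exact: bmeas_drift|by move=> h h' /(drift_indep iA)[]].
rewrite (int_even (i := i) (F := fun=> 1))//; last exact: bmeas_cst.
by rewrite Rintegral_prob_cst cardsU1 iA add1n -natr1; ring.
Qed.

(** The pairs [tanh h_i * tanh h_j] with [i != j] are uncorrelated, each of second
    moment [tau^2].  The sum is built one site at a time: the increment at [i] is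
    [2 tanh h_i * D A h]. *)
Lemma Rintegral_pair_drift2 A : \int[iid_law mu n]_h (Q A h ^+ 2)
  = 2 * #|A|%:R * (#|A|%:R - 1) * tau ^+ 2.
Proof.
elim/set_ind_card: A => [|i A iA IH].
  rewrite cards0 mulr0 !mul0r -[RHS](Rintegral_prob_cst (iid_law mu n)).
  apply: eq_Rintegral => h _.
  by rewrite /Q /pair_drift /drift !big_set0 expr0n/= subrr expr0n.
have E h : Q (i |: A) h ^+ 2 = Q A h ^+ 2 + 4 * (D A h * Q A h * tanh_field h i)
    + 4 * (D A h ^+ 2 * tanh_field h i ^+ 2).
  by rewrite /Q /D /pair_drift /drift !big_setU1//=; ring.
under eq_Rintegral do rewrite E.
have b0 : @bounded_measurable _ (n.-tuple T) R (fun h => D A h * Q A h).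
  by apply: bmeasM; [exact: bmeas_drift|exact: bmeas_pair_drift].
have b0' : @bounded_measurable _ (n.-tuple T) R (fun h => D A h ^+ 2).
  by apply: bmeasX; exact: bmeas_drift.
have b1 : @bounded_measurable _ (n.-tuple T) R (fun h => Q A h ^+ 2).
  by apply: bmeasX; exact: bmeas_pair_drift.
have b2 : @bounded_measurable _ (n.-tuple T) R
    (fun h => D A h * Q A h * tanh_field h i).
  by apply: bmeasM => //; exact: bmeas_tanh_field.
have b3 : @bounded_measurable _ (n.-tuple T) R
    (fun h => D A h ^+ 2 * tanh_field h i ^+ 2).
  by apply: bmeasM => //; apply: bmeasX; exact: bmeas_tanh_field.
have b2' := bmeasM (bmeas_cst (n.-tuple T) (4 : R)) b2.
have b3' := bmeasM (bmeas_cst (n.-tuple T) (4 : R)) b3.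
rewrite RintegralD//; [|exact: bmeas_integrable (bmeasD b1 b2')|exact: bmeas_integrable].
rewrite RintegralD//; [|exact: bmeas_integrable|exact: bmeas_integrable].
rewrite IH !RintegralZl//; [|exact: bmeas_integrable|exact: bmeas_integrable].
rewrite int_odd//; last by move=> h h' hh; have [-> ->] := drift_indep iA hh.
rewrite int_even//; last by move=> h h' hh; have [-> _] := drift_indep iA hh.
by rewrite Rintegral_drift2 cardsU1 iA add1n -natr1; ring.
Qed.

End field.

(** * The law of one sample *)

Section planted_law.
Context {R : realType}.
Variable mu : probability (measurableTypeR R) R.
Hypothesis htanh : \int[mu]_x tanh x = 0.
Variables (n : nat) (theta : R) (S : {set 'I_n}).
Hypothesis theta0 : 0 < theta.
Implicit Types (h : n.-tuple R) (s : config n).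

Let T := measurableTypeR R.
Let k : R := #|S|%:R.

(** The interaction part of the Gibbs weight. *)
Definition tilt s : R := expR (theta / 2 * (magn S s ^+ 2 / k)).

Definition partition_fun h : R := \sum_s pspin (tanh_field h) s * tilt s.

Lemma tilt_ge1 s : 1 <= tilt s.
Proof.
rewrite -expR0 /tilt ler_expR mulr_ge0 ?divr_ge0 ?sqr_ge0//; exact: ltW.
Qed.

Lemma tanh_field_bound h i : `|tanh_field h i| <= 1.
Proof. exact: tanh_bound. Qed.

Lemma partition_fun_ge1 h : 1 <= partition_fun h.
Proof.
rewrite -(sum_pspin (tanh_field h)); apply: ler_sum => s _.
rewrite ler_peMr ?tilt_ge1// pspin_ge0//; exact: tanh_field_bound.
Qed.

(** The fields enter through the product law with means [tanh h_i], as
    [exp (h s)] is [(1 + s tanh h) / 2] up to a factor independent of the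
    spin. *)
Lemma cond_pmfE h s : cond_pmf theta S h s
  = pspin (tanh_field h) s * tilt s / partition_fun h.
Proof.
pose c : R := \prod_(i < n) (expR (tnth h i) + expR (- tnth h i)).
have c0 : c != 0.
  by apply/prodf_neq0 => i _; rewrite gt_eqF// addr_gt0 ?expR_gt0.
have E tau : gibbs_weight theta S h tau = c * (pspin (tanh_field h) tau * tilt tau).
  rewrite /gibbs_weight expRD mulrC mulrA; congr (_ * _).
    rewrite /c /pspin -big_split/= expR_sum; apply: eq_bigr => i _.
    exact: expR_spin_tanh.
  rewrite /tilt; congr expR.
  have -> : \sum_(i in S) \sum_(j in S) spin (tau i) * spin (tau j)
     = magn S tau ^+ 2 :> R.
    by rewrite expr2 /magn big_distrlr.
  rewrite invfM; ring.
rewrite /cond_pmf E; under eq_bigr do rewrite E.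
rewrite -mulr_sumr -/(partition_fun h) invfM mulrACA divff// mul1r.
by [].
Qed.

Lemma bmeas_partition_fun :
  @bounded_measurable _ (n.-tuple T) R (fun h => partition_fun h).
Proof.
apply: bmeas_sum => s; apply: bmeasM; last exact: bmeas_cst.
exact: bmeas_pspin.
Qed.

Lemma bmeas_cond_pmf s :
  @bounded_measurable _ (n.-tuple T) R (fun h => cond_pmf theta S h s).
Proof.
under eq_fun do rewrite cond_pmfE.
apply: bmeasM.
  by apply: bmeasM; [exact: bmeas_pspin|exact: bmeas_cst].
by apply: bmeas_inv; [exact: bmeas_partition_fun|exact: partition_fun_ge1].
Qed.

Notation law := (@pRFCW_pmf R mu n theta S).

Lemma lawE s : law s = \int[iid_law mu n]_h cond_pmf theta S h s.
Proof. by rewrite /pRFCW_pmf unlock. Qed.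

Lemma law_ge0 s : 0 <= law s.
Proof.
rewrite lawE; apply: Rintegral_ge0 => h _; rewrite cond_pmfE.
rewrite !mulr_ge0 ?invr_ge0 ?expR_ge0//.
- by rewrite pspin_ge0//; exact: tanh_field_bound.
- by rewrite (le_trans ler01)// partition_fun_ge1.
Qed.

Lemma law_mean (G : config n -> R) :
  \sum_s law s * G s = \int[iid_law mu n]_h (\sum_s cond_pmf theta S h s * G s).
Proof.
rewrite Rintegral_sum; last first.
  by move=> s; apply: bmeasM; [exact: bmeas_cond_pmf|exact: bmeas_cst].
apply: eq_bigr => s _; rewrite RintegralZr ?lawE//.
exact: bmeas_integrable (bmeas_cond_pmf s).
Qed.

Lemma law_sum1 : \sum_s law s = 1.
Proof.
under eq_bigr do rewrite -[law _]mulr1.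
rewrite law_mean -[RHS](Rintegral_prob_cst (iid_law mu n)).
apply: eq_Rintegral => h _; under eq_bigr do rewrite mulr1 cond_pmfE.
rewrite -mulr_suml divff// gt_eqF//.
exact: lt_le_trans ltr01 (partition_fun_ge1 h).
Qed.

Lemma pspin_swap i j h s :
  pspin (tanh_field h) (swap_sites i j s)
  = pspin (tanh_field (permute_tuple (tperm i j) h)) s.
Proof.
rewrite /pspin (reindex_inj (@perm_inj _ (tperm i j)))/=.
by apply: eq_bigr => l _; rewrite ffunE tpermK /tanh_field tnth_mktuple.
Qed.

(** Swapping two spins of the clique amounts to swapping their fields, which are
    identically distributed. *)
Lemma law_exchangeable : exchangeable S law.
Proof.
move=> i j s iS jS; rewrite !lawE.
have tw u : tilt (swap_sites i j u) = tilt u by rewrite /tilt magn_swap.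
rewrite -(Rintegral_permute mu (tperm i j) (bmeas_cond_pmf s)).
apply: eq_Rintegral => h _; rewrite !cond_pmfE tw pspin_swap; congr (_ / _).
rewrite /partition_fun -(sum_swap i j); apply: eq_bigr => u _.
by rewrite tw pspin_swap.
Qed.

(** For [i] outside the clique neither the tilt nor the partition function involves
    the field at [i], so [h_i] enters only through the factor
    [1 + spin (s i) * tanh h_i], whose mean is [1]. *)
Lemma law_flip i : i \notin S -> flip_invariant i law.
Proof.
move=> iS s.
have tf u : tilt (flip i u) = tilt u by rewrite /tilt magn_flip.
have D0 h : 0 < partition_fun h by exact: lt_le_trans ltr01 (partition_fun_ge1 h).
have DE h : partition_fun h = (\sum_u pspin_off i (tanh_field h) u * tilt u) / 2.
  by rewrite /partition_fun (mean_off (i := i)).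
pose F h := pspin_off i (tanh_field h) s * tilt s / (2 * partition_fun h).
have off_indep h h' u : (forall j, j != i -> tnth h j = tnth h' j) ->
    pspin_off i (tanh_field h) u = pspin_off i (tanh_field h') u.
  by move=> hh; apply: eq_bigr => j ji; rewrite /tanh_field hh.
have Findep h h' : (forall j, j != i -> tnth h j = tnth h' j) -> F h = F h'.
  move=> hh; rewrite /F !DE (off_indep _ _ _ hh); congr (_ / (2 * (_ / 2))).
  by apply: eq_bigr => u _; rewrite (off_indep _ _ _ hh).
have bF : @bounded_measurable _ (n.-tuple T) R F.
  apply: bmeasM.
    apply: bmeasM; last exact: bmeas_cst.
    apply: bmeas_prod => j; apply: bmeasM; last exact: bmeas_cst.
    apply: bmeasD; first exact: bmeas_cst.
    by apply: bmeasM; [exact: bmeas_tanh_field|exact: bmeas_cst].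
  apply: bmeas_inv.
    by apply: bmeasM; [exact: bmeas_cst|exact: bmeas_partition_fun].
  by move=> h; have := partition_fun_ge1 h; lra.
have key (e : R) : \int[iid_law mu n]_h (F h * (1 + e * tanh_field h i))
    = \int[iid_law mu n]_h F h.
  have bt : @bounded_measurable _ T R (fun x => 1 + e * tanh x).
    apply: bmeasD; first exact: bmeas_cst.
    by apply: bmeasM; [exact: bmeas_cst|exact: bmeas_tanh].
  rewrite (Rintegral_iid_factor mu bt bF Findep).
  have bet : @bounded_measurable _ T R (fun x => e * tanh x).
    by apply: bmeasM; [exact: bmeas_cst|exact: bmeas_tanh].
  rewrite RintegralD//; [|exact: bmeas_integrable (bmeas_cst _ _)|exact: bmeas_integrable].
  rewrite Rintegral_prob_cst RintegralZl//; last exact: bmeas_integrable bmeas_tanh.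
  by rewrite htanh mulr0 addr0 mulr1.
have E h u : u = s \/ u = flip i s ->
    cond_pmf theta S h u = F h * (1 + spin (u i) * tanh_field h i).
  move=> us; rewrite cond_pmfE (pspinE i) /F.
  have [-> ->] : pspin_off i (tanh_field h) u = pspin_off i (tanh_field h) s
      /\ tilt u = tilt s.
    by case: us => ->; rewrite ?pspin_off_flip ?tf.
  by field; rewrite gt_eqF.
rewrite !lawE.
under eq_Rintegral do rewrite (E _ _ (or_intror erefl)).
under [RHS]eq_Rintegral do rewrite (E _ _ (or_introl erefl)).
by rewrite !key.
Qed.

Let tau := \int[mu]_x (tanh x ^+ 2).

(** Conditionally on the field, the tilted mean exceeds the untilted one by a
    multiple of a conditional variance.  After averaging, the first and third
    moments of [Y] are uniform ones, while the mean of the conditional variance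
    of [Y] is [3 - 2 / k - (1 + 2 (1 - 1 / k) tau^2)], which is at least
    [1 - tau^2] for [k >= 2]. *)
Lemma law_trunc_mean_ge (K : R) : 0 < K -> (1 < #|S|)%N ->
  1 - 15 / K ^+ 2
    + theta / 2 / (1 + theta / 2 * K) * ((1 - tau ^+ 2) / 2 - 15 / K)
  <= \sum_s law s * Num.min (magn S s ^+ 2 / k) K.
Proof.
move=> K0 k2.
have k0 : 0 < k by rewrite /k ltr0n (ltn_trans _ k2).
have k2R : 2 <= k by rewrite /k (ler_nat R 2).
pose kap := theta / 2 / (1 + theta / 2 * K).
have kap0 : 0 <= kap.
  have h0 : 0 < theta / 2 by rewrite divr_gt0.
  by rewrite divr_ge0 ?addr_ge0 ?mulr_ge0// ltW.
(* Conditional moments of [Y] given the field. *)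
pose m1 h := (k + pair_drift (tanh_field h) S) / k.
pose m2 h := \sum_s pspin (tanh_field h) s * (magn S s ^+ 4 / k ^+ 2).
pose m3 h := \sum_s pspin (tanh_field h) s * (magn S s ^+ 6 / k ^+ 3).
pose L h := m1 h - m3 h / K ^+ 2 + kap * ((m2 h - m1 h ^+ 2) / 2 - m3 h / K).
have pw h : L h <= \sum_s cond_pmf theta S h s * Num.min (magn S s ^+ 2 / k) K.
  have -> : \sum_s cond_pmf theta S h s * Num.min (magn S s ^+ 2 / k) K =
      (\sum_s pspin (tanh_field h) s * tilt s * Num.min (magn S s ^+ 2 / k) K)
      / (\sum_s pspin (tanh_field h) s * tilt s).
    rewrite mulr_suml; apply: eq_bigr => s _.
    by rewrite cond_pmfE -/(partition_fun h) mulrAC.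
  apply: (@tilted_trunc_mean_moments R _ (pspin (tanh_field h)) _ _
    (fun s => magn S s ^+ 2 / k) K theta) => //.
  - by move=> s; rewrite pspin_ge0//; exact: tanh_field_bound.
  - exact: sum_pspin.
  - by move=> s; rewrite divr_ge0 ?sqr_ge0// ltW.
  - rewrite /m1 /k -(mean_magn2 (tanh_field h) S) mulr_suml.
    by apply: eq_bigr => s _; rewrite mulrA.
  - by apply: eq_bigr => s _; rewrite expr_div_n -exprM.
  - by apply: eq_bigr => s _; rewrite expr_div_n -exprM.
have bm1 : @bounded_measurable _ (n.-tuple T) R m1.
  apply: bmeasM; last exact: bmeas_cst.
  by apply: bmeasD; [exact: bmeas_cst|exact: bmeas_pair_drift].
have bm2 : @bounded_measurable _ (n.-tuple T) R m2.
  by apply: bmeas_sum => s; apply: bmeasM; [exact: bmeas_pspin|exact: bmeas_cst].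
have bm3 : @bounded_measurable _ (n.-tuple T) R m3.
  by apply: bmeas_sum => s; apply: bmeasM; [exact: bmeas_pspin|exact: bmeas_cst].
have bm12 := bmeasX 2 bm1.
pose E (F : n.-tuple R -> R) := \int[iid_law mu n]_h F h.
have ED (F G : n.-tuple R -> R) : @bounded_measurable _ (n.-tuple T) R F ->
    @bounded_measurable _ (n.-tuple T) R G -> E (fun h => F h + G h) = E F + E G.
  by move=> bF bG; rewrite /E RintegralD//; exact: bmeas_integrable.
have EZ c (F : n.-tuple R -> R) : @bounded_measurable _ (n.-tuple T) R F ->
    E (fun h => c * F h) = c * E F.
  by move=> bF; rewrite /E RintegralZl//; exact: bmeas_integrable.
have bZ c (F : n.-tuple R -> R) : @bounded_measurable _ (n.-tuple T) R F ->
    @bounded_measurable _ (n.-tuple T) R (fun h => c * F h).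
  by move=> bF; apply: bmeasM => //; exact: bmeas_cst.
have bQ : @bounded_measurable _ (n.-tuple T) R (fun h => pair_drift (tanh_field h) S).
  exact: bmeas_pair_drift.
have bQ2 := bmeasX 2 bQ.
have Em1 : E m1 = 1.
  transitivity (E (fun h => 1 + k^-1 * pair_drift (tanh_field h) S)).
    by apply: eq_Rintegral => h _; rewrite /m1; field; rewrite gt_eqF.
  rewrite ED ?EZ//; [|exact: bmeas_cst|exact: bZ].
  by rewrite {1}/E Rintegral_prob_cst /E Rintegral_pair_drift// mulr0 addr0.
have Em12 : E (fun h => m1 h ^+ 2) = 1 + 2 * (1 - k^-1) * tau ^+ 2.
  transitivity (E (fun h => 1 + (2 / k * pair_drift (tanh_field h) S
     + (k ^+ 2)^-1 * pair_drift (tanh_field h) S ^+ 2))).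
    by apply: eq_Rintegral => h _; rewrite /m1; field; rewrite gt_eqF.
  rewrite !ED ?EZ//; try by [exact: bmeas_cst|exact: bZ|apply: bmeasD; exact: bZ].
  rewrite {1}/E Rintegral_prob_cst /E Rintegral_pair_drift// Rintegral_pair_drift2//.
  by rewrite -/k -/tau; field; rewrite gt_eqF.
have Em2 : E m2 = 3 - 2 / k.
  rewrite /E Rintegral_mean//.
  under eq_bigr do rewrite mulrA.
  rewrite -mulr_suml mean_unif_magn4 -/k; field; by rewrite gt_eqF.
have Em3 : E m3 <= 15.
  rewrite /E Rintegral_mean//.
  under eq_bigr do rewrite mulrA.
  rewrite -mulr_suml ler_pdivrMr ?exprn_gt0//; exact: mean_unif_magn6.
have EL : E L = E m1 - E m3 / K ^+ 2
    + kap * ((E m2 - E (fun h => m1 h ^+ 2)) / 2 - E m3 / K).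
  transitivity (E (fun h => m1 h + ((- (K ^+ 2)^-1 - kap / K) * m3 h
      + (kap / 2 * m2 h + (- (kap / 2)) * m1 h ^+ 2)))).
    apply: eq_Rintegral => h _; rewrite /L; field; rewrite gt_eqF//.
  rewrite !ED ?EZ//; try by [exact: bZ|apply: bmeasD; exact: bZ|
    apply: bmeasD; [exact: bZ|apply: bmeasD; exact: bZ]].
  by field; rewrite gt_eqF.
rewrite law_mean; apply: (@le_trans _ _ (E L)); last first.
  apply: le_Rintegral => //.
    apply: bmeas_integrable.
    apply: bmeasD.
      apply: bmeasD => //; rewrite (_ : (fun x => _) = (fun h => -(K ^+ 2)^-1 * m3 h)).
        exact: bZ.
      by apply/funext => h; ring.
    apply: (bZ).
    rewrite (_ : (fun x => _) = (fun h => (2^-1 * m2 h + (- (2^-1)) * m1 h ^+ 2)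
      + (- K^-1) * m3 h)); last by apply/funext => h; ring.
    by apply: bmeasD; [apply: bmeasD; exact: bZ|exact: bZ].
  apply: bmeas_integrable; apply: bmeas_sum => s.
  by apply: bmeasM; [exact: bmeas_cond_pmf|exact: bmeas_cst].
rewrite EL Em1 Em12 Em2 -/kap.
have K20 : 0 <= (K ^+ 2)^-1 by rewrite invr_ge0 sqr_ge0.
have Ki0 : 0 <= K^-1 by rewrite invr_ge0 ltW.
apply: lerD.
  by rewrite lerD2l lerN2; apply: ler_wpM2r.
apply: ler_wpM2l => //; apply: lerB; last exact: ler_wpM2r.
have ki : k^-1 <= 1 / 2 by rewrite div1r lef_pV2 ?posrE.
have tau2 : tau ^+ 2 <= 1.
  have t0 : 0 <= tau by apply: Rintegral_ge0 => x _; exact: sqr_ge0.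
  rewrite expr_le1// /tau -[leRHS](Rintegral_prob_cst mu); apply: le_Rintegral => //.
  - by apply: bmeas_integrable; apply: bmeasX; exact: bmeas_tanh.
  - exact: bmeas_integrable (bmeas_cst _ _).
  - by move=> x _; rewrite -real_normK ?num_real// expr_le1// tanh_bound.
have : 0 <= (1 / 2 - k^-1) * (1 - tau ^+ 2) by rewrite mulr_ge0 ?subr_ge0.
by lra.
Qed.

End planted_law.

(** * Union bound and recovery *)

Section sampling.
Context {R : realType}.

(** The indicator of a nonnegative sum is at most its exponential, which factors
    over the independent samples. *)
Lemma prod_law_chernoff (I : finType) (m : nat) (P G : I -> R) :
  (forall s, 0 <= P s) ->
  \sum_(x : {ffun 'I_m -> I} | 0 <= \sum_(i < m) G (x i)) \prod_(i < m) P (x i)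
  <= (\sum_s P s * expR (G s)) ^+ m.
Proof.
move=> P0.
have -> : (\sum_s P s * expR (G s)) ^+ m
    = \sum_(x : {ffun 'I_m -> I}) \prod_(i < m) (P (x i) * expR (G (x i))).
  by rewrite -(bigA_distr_bigA (fun _ s => P s * expR (G s)))/= prodr_const card_ord.
rewrite [leRHS](bigID (fun x : {ffun 'I_m -> I} => 0 <= \sum_(i < m) G (x i)))/=.
have pos x : 0 <= \prod_(i < m) (P (x i) * expR (G (x i))).
  by apply: prodr_ge0 => i _; rewrite mulr_ge0 ?expR_ge0.
rewrite -[leLHS]addr0; apply: lerD; last by apply: sumr_ge0 => x _.
apply: ler_sum => x x0; rewrite big_split/= -expR_sum ler_peMr//.
  by apply: prodr_ge0.
by rewrite -expR0 ler_expR.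
Qed.

(** The quadratic form [1^T s s^T 1] is the square of the sum of the spins over
    the set. *)
Lemma phiE (n m k : nat) (x : {ffun 'I_m -> config n}) (S : {set 'I_n}) :
  phi R k x S = k%:R^-1 * (m%:R^-1 * \sum_(i < m) magn S (x i) ^+ 2).
Proof.
rewrite /phi; congr (_ * _).
rewrite -scalemxAr -scalemxAl mxE; congr (_ * _).
rewrite mulmx_sumr mulmx_suml summxE; apply: eq_bigr => i _.
have E : (indicator_vec S)^T *m spin_vec (x i) = (magn S (x i))%:M :> 'M[R]_1.
  apply/matrixP => a b; rewrite !ord1 !mxE eqxx mulr1n /magn [RHS]big_mkcond/=.
  apply: eq_bigr => j _; rewrite !mxE.
  by case: (j \in S); rewrite ?mul1r ?mul0r.
have E' : (spin_vec (x i))^T *m indicator_vec S = (magn S (x i))%:M :> 'M[R]_1.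
  by rewrite -[LHS]trmxK trmx_mul trmxK E tr_scalar_mx.
by rewrite mulmxA E -mulmxA E' -scalar_mxM mxE eqxx mulr1n expr2.
Qed.

Lemma card_symdiff (T : finType) (A B : {set T}) : #|A| = #|B| ->
  (#|symdiff A B|)%:R = 2 * (#|A|%:R - #|A :&: B|%:R) :> R.
Proof.
move=> AB; rewrite /symdiff cardsU.
have -> : (A :\: B) :&: (B :\: A) = finset.set0.
  by apply/setP => x; rewrite !inE; case: (x \in A); case: (x \in B).
rewrite cards0 subn0 natrD !cardsD [B :&: A]finset.setIC -AB.
by rewrite natrB ?subset_leq_card ?finset.subsetIl//; ring.
Qed.

Lemma bin_le_exp (n k : nat) : ('C(n, k) <= n ^ k)%N.
Proof.
apply: (@leq_trans (n ^_ k)).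
  by rewrite -bin_ffact leq_pmulr// fact_gt0.
rewrite ffact_prod; apply: leq_trans (_ : \prod_(i < k) n <= _)%N.
  by apply: leq_prod => i _; exact: leq_subr.
by rewrite prod_nat_const card_ord.
Qed.

(** If some maximizer [S'] is far from [S], then in particular [phi S <= phi S'];
    the union runs over the sets [S'] of size [k] far from [S]. *)
Lemma sample_prob_misfit_le (mu : probability (measurableTypeR R) R)
    (n m k : nat) (theta delta c lam : R) (S : {set 'I_n}) :
  #|S| = k -> (0 < k)%N -> 0 <= lam ->
  (forall s, 0 <= pRFCW_pmf mu theta S s) ->
  (forall S' : {set 'I_n}, #|S'| = k -> delta * k%:R <= #|symdiff S S'|%:R ->
    \sum_s pRFCW_pmf mu theta S s
      * expR (lam * ((magn S' s ^+ 2 - magn S s ^+ 2) / k%:R)) <= expR (- c)) ->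
  sample_prob mu theta S
    (fun x : {ffun 'I_m -> config n} => [exists S' in argmax_phi R k x,
       delta * k%:R <= #|symdiff S S'|%:R])
  <= (n ^ k)%:R * expR (- (c * m%:R)).
Proof.
move=> Sk k0 lam0 P0 H; rewrite /sample_prob.
pose bad (S' : {set 'I_n}) := (#|S'| == k) && (delta * k%:R <= #|symdiff S S'|%:R).
pose ev (S' : {set 'I_n}) (x : {ffun 'I_m -> config n}) :=
  0 <= \sum_(i < m) lam * ((magn S' (x i) ^+ 2 - magn S (x i) ^+ 2) / k%:R).
have pos (x : {ffun 'I_m -> config n}) : 0 <= \prod_(i < m) pRFCW_pmf mu theta S (x i).
  by apply: prodr_ge0.
apply: (@le_trans _ _ (\sum_(S' | bad S') \sum_(x | ev S' x)
    \prod_(i < m) pRFCW_pmf mu theta S (x i))).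
  under [leRHS]eq_bigr do rewrite big_mkcond/=.
  rewrite exchange_big/= big_mkcond; apply: ler_sum => x _.
  case: ifPn => [|_]; last first.
    by apply: sumr_ge0 => S' _; case: ifP.
  move=> /existsP[S' /andP[]]; rewrite inE => /andP[cS' /forallP/(_ S)].
  rewrite Sk eqxx/= => le dS'.
  rewrite (bigD1 S')/=; last by rewrite /bad cS'.
  rewrite ifT; last first.
    rewrite /ev -mulr_sumr mulr_ge0// -mulr_suml divr_ge0// sumrB subr_ge0.
    (* For [m = 0] every [phi] vanishes and the sum over samples is empty. *)
    move: le; rewrite !phiE; have [m0|m0] := posnP m.
      by move=> _; move: m0 x {dS'} => -> x; rewrite !big_ord0.
    by rewrite !ler_pM2l ?invr_gt0 ?ltr0n.
  by rewrite lerDl; apply: sumr_ge0 => S'' _; case: ifP.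
apply: (@le_trans _ _ (\sum_(S' | bad S') expR (- (c * m%:R)))).
  apply: ler_sum => S' /andP[/eqP cS' dS'].
  apply: le_trans (prod_law_chernoff m (fun s => lam *
    ((magn S' s ^+ 2 - magn S s ^+ 2) / k%:R)) P0) _.
  rewrite -mulNr mulrC expRM_natl; apply: lerXn2r; rewrite ?nnegrE ?expR_ge0//.
    by apply: sumr_ge0 => s _; rewrite mulr_ge0 ?expR_ge0.
  exact: H.
rewrite sumr_const -[leLHS]mulr_natl; apply: ler_wpM2r; first exact: expR_ge0.
rewrite ler_nat; apply: leq_trans (bin_le_exp n k).
rewrite -[X in 'C(X, _)]card_ord -card_draws; apply: subset_leq_card.
by apply/fintype.subsetP => S'; rewrite inE => /andP[].
Qed.

(** Half of [2 k ln n <= c m] pays for the [n^k] sets; the other half leaves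
    [n^(- k) <= 1 / k]. *)
Lemma exp_count_le (n m k : nat) (c : R) : 0 < c -> (0 < k <= n)%N ->
  2 / c * k%:R * ln n%:R <= m%:R ->
  (n ^ k)%:R * expR (- (c * m%:R)) <= k%:R^-1.
Proof.
move=> c0 /andP[k0 kn] hm.
have n0 : (0 < n)%N by exact: leq_trans kn.
have nE : n%:R = expR (ln n%:R) :> R by rewrite lnK// posrE ltr0n.
have ln0 : 0 <= ln (n%:R : R) by rewrite ln_ge0// ler1n.
rewrite natrX nE -expRM_natl -expRD.
have h1 : 2 * k%:R * ln n%:R <= c * m%:R.
  have := ler_wpM2l (ltW c0) hm.
  rewrite (_ : c * (2 / c * k%:R * ln n%:R) = 2 * k%:R * ln n%:R)//.
  by field; rewrite gt_eqF.
have h2 : ln n%:R <= k%:R * ln (n%:R : R) by rewrite ler_peMl// ler1n.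
apply: (@le_trans _ _ (expR (- ln n%:R))); first by rewrite ler_expR; lra.
by rewrite expRN -nE lef_pV2 ?posrE ?ltr0n// ler_nat.
Qed.

End sampling.

(* S_max is an arbitrary maximizer: the event below says that some maximizer of
   phi is at distance at least delta * k from S. *)
Theorem corollary3p2p1 (R : realType)
    (mu : probability (measurableTypeR R) R) (theta1 : R)
    (htanh : ('E_mu[tanh] = 0)%E)
    (htheta_gt0 : 0 < theta1)
    (htheta_lt : theta1 < 1 / fine 'E_mu[fun h => (sech h ^+ 2)%R]%E) :
  forall delta : R, 0 < delta ->
  exists2 C : R, 0 < C &
    forall (n m : nat -> nat) (S : forall k : nat, {set 'I_(n k)}),
      (forall k, (k <= n k)%N) ->
      (fun k => k%:R : R) =o_\oo (fun k => (n k)%:R `^ (2 / 3) : R) ->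
      (forall k, #|S k| = k) ->
      (\forall k \near \oo, C * k%:R * ln (n k)%:R <= (m k)%:R) ->
      (fun k => sample_prob mu theta1 (S k)
         (fun x : {ffun 'I_(m k) -> config (n k)} =>
            [exists S' in argmax_phi R k x,
               delta * k%:R <= #|symdiff (S k) S'|%:R])) @ \oo --> (0 : R).
Proof.
move=> delta delta0.
have ht : \int[mu]_x tanh x = 0.
  by move: htanh; rewrite unlock /Rintegral => ->.
pose beta : R := fine 'E_mu[fun h => (sech h ^+ 2)%R]%E.
(* Positivity of [E sech^2] is read off from [0 < theta1 < 1 / E sech^2]. *)
have beta0 : 0 < beta.
  by have := lt_trans htheta_gt0 htheta_lt; rewrite div1r invr_gt0.
pose tau : R := \int[mu]_x (tanh x ^+ 2).
have bt2 := bmeasX 2 (@bmeas_tanh R).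
have betaE : beta = 1 - tau.
  rewrite /beta unlock -/(Rintegral mu setT (fun x => sech x ^+ 2)).
  under eq_Rintegral do rewrite sqr_sech.
  rewrite RintegralB//; [|exact: bmeas_integrable (bmeas_cst _ _)|exact: bmeas_integrable].
  by rewrite Rintegral_prob_cst.
have tau0 : 0 <= tau by apply: Rintegral_ge0 => x _; exact: sqr_ge0.
(* The term [2 / theta1] makes the tilt gain at least the variance over [2 K];
   the term [240 / beta] makes [15 / K <= beta / 16], so that truncation costs
   less than this gain. *)
pose K : R := 2 / theta1 + 240 / beta.
have t2 : 0 < 2 / theta1 by rewrite divr_gt0.
have b240 : 0 < 240 / beta by rewrite divr_gt0.
have K0 : 0 < K by rewrite addr_gt0.
pose c1 : R := beta / (16 * K).
have c10 : 0 < c1 by rewrite divr_gt0// mulr_gt0.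
have c1P (n : nat) (S : {set 'I_n}) : (1 < #|S|)%N ->
    1 + c1 <= \sum_s pRFCW_pmf mu theta1 S s
                * Num.min (magn S s ^+ 2 / #|S|%:R) K.
  move=> S2; apply: le_trans (law_trunc_mean_ge ht htheta_gt0 K0 S2).
  have Ki : 15 / K <= beta / 16.
    rewrite ler_pdivrMr// -ler_pdivrMl ?divr_gt0// /K.
    rewrite (_ : (beta / 16)^-1 * 15 = 240 / beta); last by field; rewrite gt_eqF.
    by rewrite lerDr ltW.
  have K2 : 15 / K ^+ 2 <= c1.
    rewrite (_ : c1 = beta / 16 / K); last by rewrite /c1; field; rewrite gt_eqF.
    rewrite (_ : 15 / K ^+ 2 = 15 / K / K); last by field; rewrite gt_eqF.
    apply: ler_wpM2r => //.
    by rewrite invr_ge0 ltW.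
  have e0 : 0 < theta1 / 2 by rewrite divr_gt0.
  have eK : 1 <= theta1 / 2 * K.
    rewrite -(@ler_pM2l _ (2 / theta1))// mulr1 mulrA.
    rewrite (_ : 2 / theta1 * (theta1 / 2) = 1) ?mul1r; last by field; rewrite gt_eqF.
    by rewrite /K lerDl ltW.
  have kap : 1 / (2 * K) <= theta1 / 2 / (1 + theta1 / 2 * K).
    rewrite ler_pdivrMr ?mulr_gt0// mulrAC ler_pdivlMr; last by lra.
    by lra.
  have br : 7 / 16 * beta <= (1 - tau ^+ 2) / 2 - 15 / K.
    have : beta * tau >= 0 by rewrite mulr_ge0// ltW.
    by move: Ki; rewrite betaE; lra.
  have := @ler_pM _ _ _ _ _ _ _ kap br.
  rewrite divr_ge0 ?mulr_ge0 ?(ltW K0) ?(ltW beta0)//.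
  have -> : 1 / (2 * K) * (7 / 16 * beta) = 7 / 2 * c1.
    by rewrite /c1; field; rewrite gt_eqF.
  by rewrite -/tau => /(_ isT isT); lra.
(* If [#|symdiff S S'| >= delta k] then [a = #|S :&: S'| / k] is at most
   [1 - delta / 2], so that [1 - a^2 >= delta / 2]. *)
pose q0 : R := delta / 2.
have q00 : 0 < q0 by rewrite divr_gt0.
pose lam : R := q0 * c1 / (160 * (K + 1) ^+ 2).
have lam0 : 0 < lam.
  apply: divr_gt0; first exact: mulr_gt0.
  by rewrite mulr_gt0// exprn_gt0// addr_gt0.
pose c2 : R := lam * q0 * c1 / 2.
have c20 : 0 < c2 by rewrite /c2 divr_gt0// mulr_gt0// mulr_gt0.
exists (2 / c2); first by rewrite divr_gt0.
move=> n m S kn _ Sk mk.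
apply: (squeeze_cvgr (f := fun=> 0) (h := fun k => 2 * harmonic k)); last 2 first.
- exact: cvg_cst.
- rewrite -(mulr0 2); apply: cvgM; first exact: cvg_cst.
  exact: cvg_harmonic.
have large : \forall k \near \oo, (k%:R : R)^-1 <= q0 * c1 / 4.
  have e0 : 0 < q0 * c1 / 4 by rewrite divr_gt0// mulr_gt0.
  near=> k; have ek : (q0 * c1 / 4)^-1 <= k%:R by near: k; exact: nbhs_infty_ger.
  have kR : 0 < (k%:R : R) by apply: lt_le_trans ek; rewrite invr_gt0.
  by rewrite -[leRHS]invrK lef_pV2 ?posrE// invr_gt0.
near=> k.
have k2 : (1 < k)%N by near: k; exact: nbhs_infty_gt.
have k0 : (0 < k)%N by exact: ltnW.
apply/andP; split.
  apply: sumr_ge0 => x _; apply: prodr_ge0 => i _.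
  exact: law_ge0.
apply: (@le_trans _ _ (k%:R^-1)); last first.
  rewrite /harmonic/= ler_pdivlMr ?ltr0n// mulrC ler_pdivrMr ?ltr0n//.
  by rewrite -natrM ler_nat mul2n -addnn -addn1 leq_add2l.
apply: (@le_trans _ _ ((n k ^ k)%:R * expR (- (c2 * (m k)%:R)))); last first.
  by apply: exp_count_le => //; [rewrite k0 kn|near: k].
apply: (@sample_prob_misfit_le R mu (n k) (m k) k theta1 delta c2 lam
  (S k) (Sk k) k0 (ltW lam0)).
  by move=> s; exact: law_ge0.
move=> S' cS' dS'.
have lawS' := @overlap_chernoff R (n k) (pRFCW_pmf mu theta1 (S k)) (S k) S' K c1 q0 lam.
move: lawS'; rewrite Sk => lawS'.
apply: (@le_trans _ _ (1 - c2)); last by rewrite expR_ge1Dx.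
apply: lawS' => //.
- by move=> s; exact: law_ge0.
- exact: law_sum1.
- exact: law_exchangeable.
- by move=> i; exact: law_flip.
- by have := c1P _ (S k); rewrite Sk; apply.
- rewrite q00/=.
  have kR : 0 < (k%:R : R) by rewrite ltr0n.
  move: dS'; rewrite card_symdiff ?Sk// => dS'.
  set a := #|S k :&: S'|%:R / k%:R.
  have a0 : 0 <= a by rewrite divr_ge0.
  have a1 : a <= 1 - q0.
    by rewrite /a ler_pdivrMr// /q0; lra.
  have : a ^+ 2 <= a by rewrite expr2 ler_piMl//; lra.
  by lra.
- by near: k.
Unshelve. all: by end_near.
Qed.
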